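(* Let $a$ and $b$ be integers with $a\ge 2$ and $\gcd(a,b)=1$, and let $x\in\mathbb{C}$ with $\operatorname{Re}(x)>0$. Put $\omega=e^{\pi i/a}$ and $q=e^{-\pi/x}$. Then $$F_{(a,b)}(x)=-\frac{2\pi}{ax}\sum_{j=0}^{a-1}\omega^{-(2j+1)b}\log\left(\prod_{m=0}^{\infty}\left(1-\omega^{2j+1}q^{2m+1}\right)\left(1-\omega^{-2j-1}q^{2m+1}\right)\right).$$
   Context: For integers $a,b$ and complex $x$, $$F_{(a,b)}(x):=\sum_{n=-\infty}^{\infty}\sum_{m=-\infty}^{\infty}\frac{(-1)^{m+n}}{(xm)^2+(an+b)^2}.$$ The series is not absolutely convergent and is interpreted as $\lim_{N\to\infty}\sum_{-N<n<N}\left(\sum_{m\in\mathbb{Z}}\frac{(-1)^{m+n}}{(xm)^2+(an+b)^2}\right)$, where for each fixed $n$ the inner sum over $m$ converges absolutely. Since $\operatorname{Re}(x)>0$, one has $|q|<1$. The logarithm of the infinite product denotes the sum of the principal logarithms of its factors, i.e. $\sum_{m=0}^{\infty}\left[\operatorname{Log}(1-\omega^{2j+1}q^{2m+1})+\operatorname{Log}(1-\omega^{-2j-1}q^{2m+1})\right]$; for real $x>0$ this is the real logarithm of a positive real number. *)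

(* Defs.v *)
From Stdlib Require Import Reals ZArith Lra Lia.
From Coquelicot Require Import Coquelicot.
Open Scope C_scope.

Definition Cexp (z : C) : C :=
  (exp (Re z) * cos (Im z), exp (Re z) * sin (Im z))%R.

(** The argument in [(-PI, PI]], for [z <> 0]. *)
Definition Carg (z : C) : R :=
  if Rle_dec 0 (Im z) then acos (Re z / Cmod z) else (- acos (Re z / Cmod z))%R.

Definition Clog (z : C) : C := (ln (Cmod z), Carg z).

Definition CpowZ (z : C) (k : Z) : C :=
  match k with
  | Z0 => 1
  | Zpos p => z ^ Pos.to_nat p
  | Zneg p => / z ^ Pos.to_nat p
  end.

(** [f] is absolutely summable over the integers, with sum [s]. *)
Definition is_abs_sum_Z (f : Z -> C) (s : C) : Prop :=
  ex_series (fun k : nat => Cmod (f (Z.of_nat k))) /\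
  ex_series (fun k : nat => Cmod (f (- Z.of_nat (S k))%Z)) /\
  exists s1 s2 : C,
    is_series (fun k : nat => f (Z.of_nat k)) s1 /\
    is_series (fun k : nat => f (- Z.of_nat (S k))%Z) s2 /\
    s = s1 + s2.

(** [g] has symmetric sum [s]: the partial sums over [-N < n < N], reindexed
    by [n = k - N] with [1 <= k <= 2 N - 1], tend to [s]. *)
Definition is_sym_sum_Z (g : Z -> C) (s : C) : Prop :=
  filterlim
    (fun N : nat =>
       sum_n_m (fun k : nat => g (Z.of_nat k - Z.of_nat N)%Z) 1 (2 * N - 1))
    eventually (locally s).

Definition F_term (a b : Z) (x : C) (n m : Z) : C :=
  CpowZ (-1) (m + n) / ((x * IZR m) ^ 2 + IZR (a * n + b) ^ 2).

(** The series [F_(a,b)(x)] converges, as an iterated sum, to [s]. *)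
Definition is_F (a b : Z) (x s : C) : Prop :=
  exists g : Z -> C,
    (forall n : Z, is_abs_sum_Z (F_term a b x n) (g n)) /\
    is_sym_sum_Z g s.

Definition omega (a : Z) : C := Cexp (PI * Ci / IZR a).

Definition nome (x : C) : C := Cexp (- PI / x).

(** The logarithm of the infinite product of [u m * v m] is [l], in the sense
    of the sum of the principal logarithms of the factors. *)
Definition is_log_prod2 (u v : nat -> C) (l : C) : Prop :=
  is_series (fun m : nat => Clog (u m) + Clog (v m)) l.

Lemma Carg_ratio_bound (z : C) : z <> 0 -> (-1 <= Re z / Cmod z <= 1)%R.
Proof.
intros Hz.
assert (Hm := proj1 (Cmod_gt_0 z) Hz).
assert (H := Rle_trans _ _ _ (Rmax_l _ _) (Rmax_Cmod z)).
change (Rabs (Re z) <= Cmod z)%R in H.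
apply Rabs_le_between in H.
split.
- apply Rle_div_r; lra.
- apply Rle_div_l; lra.
Qed.

Lemma Cmod_sqr_Re_Im (z : C) : (Cmod z * Cmod z = Re z * Re z + Im z * Im z)%R.
Proof.
unfold Cmod, Re, Im; rewrite sqrt_sqrt; [ring|].
assert (H1 := pow2_ge_0 (fst z)); assert (H2 := pow2_ge_0 (snd z)); lra.
Qed.

Lemma Carg_bound (z : C) : z <> 0 -> (- PI < Carg z <= PI)%R.
Proof.
intros Hz; unfold Carg.
assert (Hm := proj1 (Cmod_gt_0 z) Hz).
assert (Hb := Carg_ratio_bound z Hz).
assert (Ha := acos_bound (Re z / Cmod z)).
assert (Hpi := PI_RGT_0).
destruct (Rle_dec 0 (Im z)) as [Hi|Hi]; [lra|].
split; [|lra].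
destruct (Req_dec (acos (Re z / Cmod z)) PI) as [E|E]; [exfalso|lra].
assert (Hc := cos_acos _ Hb).
rewrite E, cos_PI in Hc.
assert (Hr : Re z = (- Cmod z)%R).
{ replace (Re z) with (Re z / Cmod z * Cmod z)%R by (field; lra).
  rewrite <- Hc; ring. }
assert (Hs := Cmod_sqr_Re_Im z); rewrite Hr in Hs; nra.
Qed.

Lemma Cexp_Clog (z : C) : z <> 0 -> Cexp (Clog z) = z.
Proof.
intros Hz.
assert (Hm := proj1 (Cmod_gt_0 z) Hz).
assert (Hb := Carg_ratio_bound z Hz).
assert (Hs := Cmod_sqr_Re_Im z).
assert (Hq : (1 - Rsqr (Re z / Cmod z) = Rsqr (Im z / Cmod z))%R).
{ unfold Rsqr; replace 1%R with (Cmod z * Cmod z / (Cmod z * Cmod z))%R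
    by (field; lra).
  rewrite Hs at 1; field; lra. }
rewrite (surjective_pairing z) at 2.
unfold Cexp, Clog, Carg; simpl; rewrite (exp_ln _ Hm).
fold (Re z) (Im z).
destruct (Rle_dec 0 (Im z)) as [Hi|Hi];
  rewrite ?cos_neg, ?sin_neg, (cos_acos _ Hb), (sin_acos _ Hb), Hq, sqrt_Rsqr_abs;
  unfold Rdiv; rewrite Rabs_mult, (Rabs_pos_eq (/ Cmod z))
    by (left; apply Rinv_0_lt_compat; lra).
- rewrite (Rabs_pos_eq (Im z)) by lra; f_equal; field; lra.
- rewrite (Rabs_left (Im z)) by lra; f_equal; field; lra.
Qed.

(* Main.v *)
(** For [c = a n + b], the partial fraction expansion
    [sum_m (-1)^m / (z^2 + m^2) = PI / (z sinh (PI z))] at [z = |c| / x] turns the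
    inner sum of [F] into [(-1)^n (2 PI / x) h |c|], where [h r = q^r / (r (1 - q^(2 r)))].
    On the other side, expand each [Clog (1 - zeta q^(2m+1))] as a power series and sum
    over the [a]-th roots [zeta] of [-1] with the weights [zeta^(-b)]: only the exponents
    [+- r = a n + b] survive, with coefficient [a (-1)^n], and the sum over [m] is a
    geometric series giving [h r] again.

    The partial fraction expansion is the convergence at [0] of the Fourier series of
    [cosh (z t)]. Cesaro means suffice, and since the Fejer kernel is [O(1 / t^2)]
    before normalization while [cosh (z t) - 1 = O(t^2)], the summed errors stay bounded. *)

Require Import Defs.
From Stdlib Require Import Reals ZArith Lra Lia.
From Coquelicot Require Import Coquelicot.
Open Scope C_scope.

(** Convergence of the partial fraction series is known beforehand, from the decay [1 / k^2] of its
    terms; only its value remains to be identified, which is why control of averages is enough. No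
    integral occurs: explicit antiderivatives and a mean value inequality on [[0, PI]] take its
    place, and the power series of [Clog] comes from the same inequality along the segment from [1]
    to [1 - w]. The final identity compares two summations of a single function on the integers,
    [root_sum a (r - b)] times the Lambert coefficient of [|r|]. The logarithms deliver it with [r]
    and [- r] grouped together; [F] delivers it along [r = a n + b] with a symmetric cutoff in [n].
    Since each half of the sum converges by itself, the two groupings agree. Coprimality together
    with [a >= 2] keeps [r = 0], where the Lambert coefficient has a zero denominator, out of the
    progression. *)

(** Equations between sums are typed in the carrier of an algebraic structure; restating them in [C]
    lets [ring] and [field] recognise the type. *)
Ltac cring := match goal with |- @eq _ ?z ?w => change (@eq C z w) end; ring.
Ltac cfield := match goal with |- @eq _ ?z ?w => change (@eq C z w) end; field.

(** * The complex exponential and elementary bounds on the modulus *)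

Lemma C_ext (z w : C) : Re z = Re w -> Im z = Im w -> z = w.
Proof. destruct z, w; simpl; intros -> ->; reflexivity. Qed.

Lemma Cexp_add (z w : C) : Cexp (z + w) = Cexp z * Cexp w.
Proof.
destruct z as [u v], w as [u' v']; unfold Cexp; apply C_ext; simpl;
  rewrite exp_plus, ?cos_plus, ?sin_plus; ring.
Qed.

Lemma Cexp_0 : Cexp 0 = 1.
Proof.
unfold Cexp; apply C_ext; simpl; rewrite exp_0, ?cos_0, ?sin_0; ring.
Qed.

Lemma Cmod_Cexp (z : C) : Cmod (Cexp z) = exp (Re z).
Proof.
unfold Cmod, Cexp; simpl.
replace (_ + _)%R with (exp (Re z) * exp (Re z) * (Rsqr (sin (Im z)) + Rsqr (cos (Im z))))%R
  by (unfold Rsqr; ring).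
rewrite sin2_cos2, Rmult_1_r.
apply sqrt_square; left; apply exp_pos.
Qed.

Lemma Cexp_neq_0 (z : C) : Cexp z <> 0.
Proof. apply Cmod_gt_0; rewrite Cmod_Cexp; apply exp_pos. Qed.

Lemma Cexp_opp (z : C) : Cexp (- z) = / Cexp z.
Proof.
assert (H := Cexp_neq_0 z).
replace (Cexp (- z)) with (Cexp (- z) * Cexp z * / Cexp z) by (field; auto).
rewrite <- Cexp_add; replace (- z + z) with (0 : C) by ring.
rewrite Cexp_0; ring.
Qed.

Lemma Cexp_pow (z : C) (n : nat) : Cexp z ^ n = Cexp (INR n * z).
Proof.
induction n as [|n IH].
- simpl; replace (0 * z) with (0 : C) by ring; now rewrite Cexp_0.
- rewrite Cpow_S, IH, <- Cexp_add, S_INR; f_equal; rewrite RtoC_plus; ring.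
Qed.

Lemma CpowZ_Cexp (z : C) (k : Z) : CpowZ (Cexp z) k = Cexp (IZR k * z).
Proof.
destruct k as [|p|p]; simpl.
- replace (0 * z) with (0 : C) by ring; now rewrite Cexp_0.
- now rewrite Cexp_pow, INR_IPR.
- rewrite Cexp_pow, INR_IPR, <- Cexp_opp; f_equal.
  change (IZR (Z.neg p)) with (- IPR p)%R; rewrite RtoC_opp; ring.
Qed.

Lemma Cmod_Cexp_le (z : C) : (Cmod (Cexp z) <= exp (Cmod z))%R.
Proof.
rewrite Cmod_Cexp.
assert (H := re_le_Cmod z); apply Rabs_le_between in H.
destruct (Req_dec (Re z) (Cmod z)) as [->|E]; [lra|].
left; apply exp_increasing; lra.
Qed.

Lemma Cmod_le_Re_Im (z : C) : (Cmod z <= Rabs (Re z) + Rabs (Im z))%R.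
Proof.
replace z with (RtoC (Re z) + Ci * Im z) at 1 by (apply C_ext; simpl; ring).
eapply Rle_trans; [apply Cmod_triangle|].
rewrite Cmod_mult, Cmod_Ci, !Cmod_R; lra.
Qed.

Lemma im_le_Cmod (z : C) : (Rabs (Im z) <= Cmod z)%R.
Proof.
eapply Rle_trans; [|apply Rmax_Cmod]; apply Rmax_r.
Qed.

Lemma Cmod_ge_minus (z w : C) : (Cmod z - Cmod w <= Cmod (z + w))%R.
Proof.
assert (H := Cmod_triangle (z + w) (- w)).
replace (z + w + - w) with z in H by ring; rewrite Cmod_opp in H; lra.
Qed.

(** * Complex functions of a real variable *)

(** Componentwise, so that [auto_derive] and the real mean value theorem apply to each part. *)
Definition is_Cderive (f : R -> C) (t : R) (l : C) : Prop :=
  is_derive (fun s => Re (f s)) t (Re l) /\ is_derive (fun s => Im (f s)) t (Im l).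

Lemma is_Cderive_const (c : C) (t : R) : is_Cderive (fun _ => c) t 0.
Proof. split; apply (is_derive_const (V := R_NormedModule)). Qed.

Lemma is_Cderive_plus (f g : R -> C) (t : R) (df dg : C) :
  is_Cderive f t df -> is_Cderive g t dg ->
  is_Cderive (fun s => f s + g s) t (df + dg).
Proof.
intros [Hf1 Hf2] [Hg1 Hg2]; split.
- exact (is_derive_plus (V := R_NormedModule) _ _ _ _ _ Hf1 Hg1).
- exact (is_derive_plus (V := R_NormedModule) _ _ _ _ _ Hf2 Hg2).
Qed.

Lemma is_Cderive_mult (f g : R -> C) (t : R) (df dg : C) :
  is_Cderive f t df -> is_Cderive g t dg ->
  is_Cderive (fun s => f s * g s) t (df * g t + f t * dg).
Proof.
intros [Hf1 Hf2] [Hg1 Hg2]; split.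
- replace (Re _) with ((Re df * Re (g t) + Re (f t) * Re dg)
    - (Im df * Im (g t) + Im (f t) * Im dg))%R by (destruct df, dg, (f t), (g t); simpl; ring).
  exact (is_derive_minus (V := R_NormedModule) _ _ _ _ _
    (Derive.is_derive_mult _ _ _ _ _ Hf1 Hg1) (Derive.is_derive_mult _ _ _ _ _ Hf2 Hg2)).
- replace (Im _) with ((Re df * Im (g t) + Re (f t) * Im dg)
    + (Im df * Re (g t) + Im (f t) * Re dg))%R by (destruct df, dg, (f t), (g t); simpl; ring).
  exact (is_derive_plus (V := R_NormedModule) _ _ _ _ _
    (Derive.is_derive_mult _ _ _ _ _ Hf1 Hg2) (Derive.is_derive_mult _ _ _ _ _ Hf2 Hg1)).
Qed.

Lemma is_Cderive_RtoC (f : R -> R) (t l : R) :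
  is_derive f t l -> is_Cderive (fun s => RtoC (f s)) t (RtoC l).
Proof.
intros H; split; [exact H|exact (is_derive_const (V := R_NormedModule) (0 : R) t)].
Qed.

Lemma is_Cderive_eq (f : R -> C) (t : R) (l l' : C) :
  l = l' -> is_Cderive f t l -> is_Cderive f t l'.
Proof. intros ->; auto. Qed.

Lemma is_Cderive_scal (c : C) (f : R -> C) (t : R) (df : C) :
  is_Cderive f t df -> is_Cderive (fun s => c * f s) t (c * df).
Proof.
intros H.
apply is_Cderive_eq with (0 * f t + c * df); [ring|].
apply (is_Cderive_mult (fun _ => c)); auto using is_Cderive_const.
Qed.

Lemma is_Cderive_Cexp (w : C) (t : R) :
  is_Cderive (fun s => Cexp (s * w)) t (w * Cexp (t * w)).
Proof.
destruct w as [u v]; split; unfold Cexp; simpl; auto_derive; auto; unfold Rminus; ring.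
Qed.

Lemma MVT_abs_bound (f df : R -> R) (T D : R) :
  (0 <= T)%R ->
  (forall t, (0 <= t <= T)%R -> is_derive f t (df t) /\ (Rabs (df t) <= D)%R) ->
  (Rabs (f T - f 0) <= D * T)%R.
Proof.
intros HT H.
destruct (MVT_gen f 0 T df) as [c [Hc ->]];
  rewrite ?Rmin_left, ?Rmax_right in * by lra.
- intros t Ht; apply H; lra.
- intros t Ht; apply continuity_pt_filterlim.
  apply (ex_derive_continuous (V := R_NormedModule)).
  eexists; apply H; lra.
- rewrite Rabs_mult, (Rabs_pos_eq (T - 0)) by lra.
  rewrite Rminus_0_r; apply Rmult_le_compat_r; [lra|]; now apply H.
Qed.

(** The real inequality is applied to each component, whence the factor 2; only the order of
    magnitude matters later. *)
Lemma MVT_Cmod_bound (f df : R -> C) (T D : R) :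
  (0 <= T)%R ->
  (forall t, (0 <= t <= T)%R -> is_Cderive f t (df t) /\ (Cmod (df t) <= D)%R) ->
  (Cmod (f T - f 0%R) <= 2 * D * T)%R.
Proof.
intros HT H.
eapply Rle_trans; [apply Cmod_le_Re_Im|].
assert (H1 : (Rabs (Re (f T) - Re (f 0%R)) <= D * T)%R).
{ apply (MVT_abs_bound (fun t => Re (f t)) (fun t => Re (df t))); auto.
  intros t Ht; destruct (H t Ht) as [[Hd _] Hb]; split; auto.
  eapply Rle_trans; [apply re_le_Cmod|auto]. }
assert (H2 : (Rabs (Im (f T) - Im (f 0%R)) <= D * T)%R).
{ apply (MVT_abs_bound (fun t => Im (f t)) (fun t => Im (df t))); auto.
  intros t Ht; destruct (H t Ht) as [[_ Hd] Hb]; split; auto.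
  eapply Rle_trans; [apply im_le_Cmod|auto]. }
change (Re (f T - f 0%R)) with (Re (f T) - Re (f 0%R))%R.
change (Im (f T - f 0%R)) with (Im (f T) - Im (f 0%R))%R; lra.
Qed.

(** * Sums and series *)

Lemma sum_n_S (u : nat -> C) (n : nat) : sum_n u (S n) = sum_n u n + u (S n).
Proof. exact (sum_Sn (G := C_AbelianMonoid) u n). Qed.

Lemma sum_n_ext_C (u v : nat -> C) (n : nat) :
  (forall k, (k <= n)%nat -> u k = v k) -> sum_n u n = sum_n v n.
Proof. apply sum_n_ext_loc. Qed.

Lemma sum_n_scal_C (c : C) (u : nat -> C) (n : nat) :
  sum_n (fun k => c * u k) n = c * sum_n u n.
Proof. exact (sum_n_mult_l (K := C_Ring) c u n). Qed.

Lemma sum_n_plus_C (u v : nat -> C) (n : nat) :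
  sum_n (fun k => u k + v k) n = sum_n u n + sum_n v n.
Proof. exact (sum_n_plus (G := C_AbelianMonoid) u v n). Qed.

Lemma sum_n_minus_C (u v : nat -> C) (n : nat) :
  sum_n (fun k => u k - v k) n = sum_n u n - sum_n v n.
Proof.
induction n as [|n IH]; [now rewrite !sum_O|].
rewrite !sum_n_S, IH; cring.
Qed.

Lemma Cmod_sum_n_le (u : nat -> C) (v : nat -> R) (n : nat) :
  (forall k, (k <= n)%nat -> (Cmod (u k) <= v k)%R) ->
  (Cmod (sum_n u n) <= sum_n v n)%R.
Proof.
intros H; induction n as [|n IH].
- rewrite !sum_O; auto.
- rewrite sum_n_S, sum_Sn.
  eapply Rle_trans; [apply Cmod_triangle|].
  apply Rplus_le_compat; auto.
Qed.

(** Reduces complex limits to real sequences tending to 0, where squeezing is available. *)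
Lemma filterlim_C_iff (u : nat -> C) (l : C) :
  filterlim u eventually (locally (T := C_UniformSpace) l) <->
  is_lim_seq (fun n => Cmod (u n - l)) 0.
Proof.
split; intros H.
- apply is_lim_seq_spec; intros [eps He]; simpl.
  assert (P := proj1 (filterlim_locally_ball_norm (U := C_NormedModule) u l) H
    (mkposreal eps He)).
  destruct P as [N HN]; exists N; intros n Hn; specialize (HN n Hn).
  rewrite Rminus_0_r, Rabs_pos_eq by apply Cmod_ge_0.
  exact HN.
- apply is_lim_seq_spec in H.
  apply (proj2 (filterlim_locally_ball_norm (U := C_NormedModule) u l)).
  intros eps; destruct (H eps) as [N HN]; exists N; intros n Hn; specialize (HN n Hn).
  rewrite Rminus_0_r, Rabs_pos_eq in HN by apply Cmod_ge_0.
  exact HN.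
Qed.

Lemma is_series_C_iff (u : nat -> C) (l : C) :
  is_series u l <-> is_lim_seq (fun n => Cmod (sum_n u n - l)) 0.
Proof. apply filterlim_C_iff. Qed.

Lemma is_lim_seq_squeeze_0 (u v : nat -> R) :
  (forall n, (0 <= u n <= v n)%R) -> is_lim_seq v 0 -> is_lim_seq u 0.
Proof.
intros H Hv.
apply (is_lim_seq_le_le (fun _ => 0%R) u v); auto using is_lim_seq_const.
Qed.

Lemma filterlim_C_unique (u : nat -> C) (l l' : C) :
  filterlim u eventually (locally (T := C_UniformSpace) l) ->
  filterlim u eventually (locally (T := C_UniformSpace) l') -> l = l'.
Proof.
exact (filterlim_locally_unique (V := C_NormedModule) (F := eventually) u l l').
Qed.

Lemma ex_series_Cmod_le (u : nat -> C) (v : nat -> R) :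
  (forall n, (Cmod (u n) <= v n)%R) -> ex_series v ->
  ex_series (fun n => Cmod (u n)).
Proof.
intros H Hv; apply (ex_series_le (V := R_CompleteNormedModule) _ v); auto.
intros n; change (Rabs (Cmod (u n)) <= v n)%R.
rewrite Rabs_pos_eq by apply Cmod_ge_0; auto.
Qed.

Lemma ex_series_C (u : nat -> C) :
  ex_series (fun n => Cmod (u n)) -> exists l : C, is_series u l.
Proof.
intros H; apply (ex_series_le (V := C_CompleteNormedModule) u _ (fun n => Rle_refl _) H).
Qed.

Lemma is_series_plus_C (u v : nat -> C) (l l' : C) :
  is_series u l -> is_series v l' -> is_series (fun n => u n + v n) (l + l').
Proof. apply (is_series_plus (V := C_NormedModule)). Qed.

Lemma is_series_scal_C (c : C) (u : nat -> C) (l : C) :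
  is_series u l -> is_series (fun n => c * u n) (c * l).
Proof. apply (is_series_scal (V := C_NormedModule)). Qed.

Lemma is_series_ext_C (u v : nat -> C) (l : C) :
  (forall n, u n = v n) -> is_series u l -> is_series v l.
Proof. apply is_series_ext. Qed.

Lemma is_series_sum_n (u : nat -> nat -> C) (l : nat -> C) (J : nat) :
  (forall j, (j <= J)%nat -> is_series (u j) (l j)) ->
  is_series (fun n => sum_n (fun j => u j n) J) (sum_n l J).
Proof.
induction J as [|J IH]; intros H.
- rewrite sum_O; apply is_series_ext_C with (u O); auto.
  intros n; now rewrite sum_O.
- rewrite sum_n_S.
  apply is_series_ext_C with (fun n => sum_n (fun j => u j n) J + u (S J) n).
  + intros n; now rewrite sum_n_S.
  + apply is_series_plus_C; auto.
Qed.

Lemma Cmod_series_le (u : nat -> C) (v : nat -> R) (l : C) (s : R) :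
  (forall n, (Cmod (u n) <= v n)%R) -> is_series u l -> is_series v s ->
  (Cmod l <= s)%R.
Proof.
intros H Hu Hv.
apply is_series_C_iff in Hu.
assert (Hv' : is_lim_seq (sum_n v) s) by exact Hv.
assert (E := is_lim_seq_plus' _ _ _ _ Hv' Hu).
rewrite Rplus_0_r in E.
assert (L : Rbar_le (Cmod l) s).
{ apply (is_lim_seq_le (fun _ => Cmod l) (fun n => sum_n v n + Cmod (sum_n u n - l))%R);
    [|apply is_lim_seq_const|exact E].
  intros n.
  assert (B := Cmod_sum_n_le u v n (fun k _ => H k)).
  (* [|l|] is at most [|S_n| + |S_n - l|] for the partial sums [S_n]; the second term vanishes in
     the limit. *)
  assert (T := Cmod_triangle (sum_n u n) (- (sum_n u n - l))).
  rewrite Cmod_opp in T.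
  replace (sum_n u n + - (sum_n u n - l)) with l in T by cring; lra. }
exact L.
Qed.

(** * The logarithmic series *)

(** In the right half-plane this replaces the two-case [acos] formula by a single differentiable
    one, valid across the real axis. *)
Lemma Carg_atan (z : C) : (0 < Re z)%R -> Carg z = atan (Im z / Re z).
Proof.
intros Hz.
assert (Hn : z <> 0) by (intros ->; simpl in Hz; lra).
assert (Hm := proj1 (Cmod_gt_0 z) Hn).
assert (Hs := Cmod_sqr_Re_Im z).
assert (Hc : (Re z / Cmod z)%R = cos (atan (Im z / Re z))).
{ rewrite cos_atan.
  replace (1 + Rsqr (Im z / Re z))%R with (Rsqr (Cmod z / Re z)).
  - rewrite sqrt_Rsqr by (apply Rlt_le, Rdiv_lt_0_compat; auto). field; lra.
  - unfold Rsqr, Rdiv.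
    replace (Cmod z * / Re z * (Cmod z * / Re z))%R with
      (Cmod z * Cmod z * / (Re z * Re z))%R by (field; lra).
    rewrite Hs; field; lra. }
assert (Hb := atan_bound (Im z / Re z)).
unfold Carg; rewrite Hc.
destruct (Rle_dec 0 (Im z)) as [Hi|Hi].
- apply acos_cos; split; [|lra].
  destruct (Req_dec (Im z) 0) as [->|E].
  + unfold Rdiv; rewrite Rmult_0_l, atan_0; lra.
  + rewrite <- atan_0; left; apply atan_increasing, Rdiv_lt_0_compat; lra.
- rewrite <- cos_neg, acos_cos; [ring|split; [|lra]].
  rewrite <- atan_opp, <- atan_0; left; apply atan_increasing.
  unfold Rdiv; rewrite <- Ropp_mult_distr_l_reverse; apply Rdiv_lt_0_compat; lra.
Qed.

Lemma Cdiv_eq (p z d : C) : d <> 0 -> z = p * d -> p = z / d.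
Proof. intros Hd ->; field; auto. Qed.

Lemma is_Cderive_Clog_ray (w : C) (t : R) :
  (0 < 1 - t * Re w)%R ->
  is_Cderive (fun s => Clog (1 - s * w)) t (- w / (1 - t * w)).
Proof.
destruct w as [u v]; simpl; intros Ht.
set (D := ((1 - t * u) ^ 2 + (t * v) ^ 2)%R).
assert (HD : (0 < D)%R) by (unfold D; nra).
replace (- (u, v) / (1 - t * (u, v)))
  with ((- (u * (1 - t * u) - t * v ^ 2) / D, - v / D)%R : C).
2:{ assert (N : 1 - t * (u, v) <> 0).
    { intros E; apply (f_equal Re) in E; simpl in E; lra. }
    apply Cdiv_eq; auto.
    unfold D in *; apply C_ext; simpl; field; simpl in HD; lra. }
(* The closed formulas for modulus and argument hold only where the real part is positive; this is
   an open condition, so the derivative at [t] can be computed from them. *)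
assert (L : locally t (fun s => 0 < 1 - s * u)%R).
{ assert (Cn : continuous (fun s => (1 - s * u)%R) t).
  { apply (ex_derive_continuous (V := R_NormedModule)); auto_derive; auto. }
  apply Cn; apply open_gt; exact Ht. }
split; simpl.
- apply is_derive_ext_loc with (fun s => (/ 2 * ln ((1 - s * u) ^ 2 + (s * v) ^ 2))%R).
  2:{ unfold D in *; auto_derive; [simpl in HD; lra|simpl; field; simpl in HD; lra]. }
  revert L; apply filter_imp; intros s Hs; unfold Cmod; simpl.
  match goal with |- _ = ln (sqrt ?y) => set (X := y) end.
  assert (HX : (0 < X)%R) by (unfold X; nra).
  replace (_ + _)%R with (sqrt X * sqrt X)%R
    by (rewrite sqrt_sqrt by lra; unfold X; ring).
  rewrite ln_mult by now apply sqrt_lt_R0.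
  lra.
- apply is_derive_ext_loc with (fun s => atan (- (s * v) / (1 - s * u))%R).
  2:{ unfold D in *; auto_derive; [lra|unfold Rsqr; field; simpl in HD; lra]. }
  revert L; apply filter_imp; intros s Hs; rewrite Carg_atan; simpl; [f_equal; f_equal; try ring; f_equal; ring|lra].
Qed.

(** The first [N] terms of the series of [- log (1 - w)]. The case [O] is separate because [sum_n]
    always includes index 0. *)
Definition log_partial (w : C) (N : nat) : C :=
  match N with O => 0 | S k => sum_n (fun r => w ^ S r / INR (S r)) k end.

Lemma log_partial_S (w : C) (N : nat) :
  log_partial w (S N) = log_partial w N + w ^ S N / INR (S N).
Proof.
destruct N as [|N]; [|apply sum_n_S].
unfold log_partial; rewrite sum_O; cring.
Qed.

Lemma INR_S_neq_0 (n : nat) : RtoC (INR (S n)) <> 0.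
Proof. intros E; apply RtoC_inj in E; now apply (not_0_INR (S n)) in E. Qed.

Lemma is_Cderive_pow (f : R -> C) (t : R) (df : C) (n : nat) :
  is_Cderive f t df -> is_Cderive (fun s => f s ^ S n) t (INR (S n) * f t ^ n * df).
Proof.
intros H; induction n as [|n IH].
- apply is_Cderive_eq with (df * f t ^ 0 + f t * 0); [simpl; ring|].
  apply (is_Cderive_mult f); auto using is_Cderive_const.
- apply is_Cderive_eq with (df * f t ^ S n + f t * (INR (S n) * f t ^ n * df)).
  + rewrite (S_INR (S n)), RtoC_plus, (Cpow_S (f t) n); ring.
  + apply (is_Cderive_mult f _ t _ _ H IH).
Qed.

Lemma is_Cderive_RtoC_mult (w : C) (t : R) : is_Cderive (fun s => s * w) t w.
Proof.
apply is_Cderive_eq with (1 * w + t * 0); [ring|].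
apply (is_Cderive_mult (fun s => RtoC s) (fun _ => w)); [|apply is_Cderive_const].
apply is_Cderive_RtoC, (is_derive_id (K := R_AbsRing)).
Qed.

(** Differentiating term by term leaves the geometric sum of [w (t w)^r] over [r < N], here in
    closed form. *)
Lemma is_Cderive_log_partial (w : C) (t : R) (N : nat) :
  1 - t * w <> 0 ->
  is_Cderive (fun s => log_partial (s * w) N) t (w * (1 - (t * w) ^ N) / (1 - t * w)).
Proof.
intros Hw; induction N as [|N IH].
- apply is_Cderive_eq with (RtoC 0); [simpl; field; auto|].
  exact (is_Cderive_const 0 t).
- apply is_Cderive_eq with (w * (1 - (t * w) ^ N) / (1 - t * w) +
    / INR (S N) * (INR (S N) * (t * w) ^ N * w)).
  + rewrite Cpow_S; field; split; auto using INR_S_neq_0.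
  + assert (H := is_Cderive_plus _ _ t _ _ IH (is_Cderive_scal (/ INR (S N)) _ t _
      (is_Cderive_pow _ t _ N (is_Cderive_RtoC_mult w t)))).
    destruct H as [H1 H2]; split;
    [revert H1|revert H2]; apply is_derive_ext; intros s; rewrite log_partial_S;
      f_equal; unfold Cdiv; ring.
Qed.

Lemma Cmod_one_minus_ge (w : C) (t : R) :
  (0 <= t <= 1)%R -> (1 - Cmod w <= Cmod (1 - t * w))%R.
Proof.
intros Ht.
assert (H := Cmod_ge_minus 1 (- (t * w))).
rewrite Cmod_opp, Cmod_mult, Cmod_1, Cmod_R, Rabs_pos_eq in H by lra.
assert (P := Cmod_ge_0 w).
replace (1 - t * w) with (1 + - (t * w)) by ring; nra.
Qed.

(** Along [t] in [[0, 1]] the two derivatives cancel up to [- w (t w)^N / (1 - t w)], and the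
    function vanishes at [t = 0]. *)
Lemma Cmod_Clog_log_partial (w : C) (N : nat) :
  (Cmod w < 1)%R ->
  (Cmod (Clog (1 - w) + log_partial w N) <= 2 * (Cmod w ^ S N / (1 - Cmod w)))%R.
Proof.
intros Hw.
assert (P := Cmod_ge_0 w).
assert (Hn : forall t, (0 <= t <= 1)%R -> 1 - t * w <> 0).
{ intros t Ht; apply Cmod_gt_0; assert (H := Cmod_one_minus_ge w t Ht); lra. }
assert (H := MVT_Cmod_bound (fun t => Clog (1 - t * w) + log_partial (t * w) N)
  (fun t => - w / (1 - t * w) + w * (1 - (t * w) ^ N) / (1 - t * w))
  1 (Cmod w ^ S N / (1 - Cmod w)) Rle_0_1).
assert (Z : Clog (1 - 0%R * w) + log_partial (0%R * w) N = 0).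
{ replace (1 - 0%R * w) with (RtoC 1) by ring.
  replace (0%R * w) with (RtoC 0) by ring.
  replace (Clog 1) with (RtoC 0).
  - clear; induction N as [|N IH]; [simpl; ring|].
    rewrite log_partial_S, Cplus_assoc, IH, Cpow_S; unfold Cdiv; ring.
  - unfold Clog; rewrite Carg_atan by (simpl; lra); simpl.
    rewrite Cmod_1, ln_1; unfold Rdiv; now rewrite Rmult_0_l, atan_0. }
cbv beta in H; rewrite Z in H.
replace (Clog (1 - w) + log_partial w N) with (Clog (1 - 1%R * w) + log_partial (1%R * w) N - 0).
2:{ rewrite !Cmult_1_l; ring. }
eapply Rle_trans; [apply H|lra].
intros t Ht; split.
- apply is_Cderive_plus; [apply is_Cderive_Clog_ray|apply is_Cderive_log_partial; auto].
  assert (R1 := re_le_Cmod w); apply Rabs_le_between in R1; nra.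
- replace (- w / (1 - t * w) + w * (1 - (t * w) ^ N) / (1 - t * w))
    with (- (w * (t * w) ^ N / (1 - t * w))) by (field; auto).
  rewrite Cmod_opp, Cmod_div, !Cmod_mult, Cmod_pow, Cmod_mult, Cmod_R by auto.
  rewrite Rabs_pos_eq by lra.
  assert (G := Cmod_one_minus_ge w t Ht).
  assert (T : ((t * Cmod w) ^ N <= Cmod w ^ N)%R) by (apply pow_incr; nra).
  assert (T0 : (0 <= (t * Cmod w) ^ N)%R) by (apply pow_le; nra).
  simpl; unfold Rdiv; apply Rmult_le_compat.
  + nra.
  + left; apply Rinv_0_lt_compat; lra.
  + nra.
  + apply Rinv_le_contravar; lra.
Qed.

Lemma is_series_Clog (w : C) :
  (Cmod w < 1)%R -> is_series (fun r : nat => w ^ S r / INR (S r)) (- Clog (1 - w)).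
Proof.
intros Hw; apply is_series_C_iff.
assert (P := Cmod_ge_0 w).
apply is_lim_seq_squeeze_0 with
  (fun n => 2 * Cmod w ^ 2 / (1 - Cmod w) * Cmod w ^ n)%R.
- intros n; split; [apply Cmod_ge_0|].
  assert (H := Cmod_Clog_log_partial w (S n) Hw).
  replace (sum_n _ n - - Clog (1 - w)) with (Clog (1 - w) + log_partial w (S n))
    by (unfold log_partial; cring).
  eapply Rle_trans; [apply H|]; simpl; unfold Rdiv; lra.
- replace (Finite 0) with (Rbar_mult (2 * Cmod w ^ 2 / (1 - Cmod w))%R 0)
    by (simpl; f_equal; ring).
  apply is_lim_seq_scal_l, is_lim_seq_geom; rewrite Rabs_pos_eq; auto.
Qed.

Lemma Cmod_Clog_le (w : C) :
  (Cmod w < 1)%R -> (Cmod (Clog (1 - w)) <= 2 * (Cmod w / (1 - Cmod w)))%R.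
Proof.
intros Hw; assert (H := Cmod_Clog_log_partial w 0 Hw).
simpl in H; rewrite Cplus_0_r, Rmult_1_r in H; exact H.
Qed.

(** * The partial fraction expansion of 1 / sinh *)

Definition Ccosh (z : C) : C := (Cexp z + Cexp (- z)) / 2.
Definition Csinh (z : C) : C := (Cexp z - Cexp (- z)) / 2.

Lemma two_neq_0_C : RtoC 2 <> 0.
Proof. intros E; apply RtoC_inj in E; lra. Qed.

Lemma Csinh_0 : Csinh 0 = 0.
Proof.
unfold Csinh; replace (- 0) with (RtoC 0) by ring; field; apply two_neq_0_C.
Qed.

Lemma Ccosh_0 : Ccosh 0 = 1.
Proof.
unfold Ccosh; replace (- 0) with (RtoC 0) by ring; rewrite Cexp_0; field; apply two_neq_0_C.
Qed.

Lemma is_Cderive_Cexp_opp (z : C) (t : R) :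
  is_Cderive (fun s => Cexp (- (s * z))) t (- z * Cexp (- (t * z))).
Proof.
assert (E : forall s : R, - (s * z) = s * - z) by (intros s; ring).
rewrite E.
destruct (is_Cderive_Cexp (- z) t) as [H1 H2]; split;
  [revert H1|revert H2]; apply is_derive_ext; intros s; now rewrite E.
Qed.

Lemma is_Cderive_Ccosh (z : C) (t : R) :
  is_Cderive (fun s => Ccosh (s * z)) t (z * Csinh (t * z)).
Proof.
apply is_Cderive_eq with
  ((z * Cexp (t * z) + - z * Cexp (- (t * z))) * / 2 + (Cexp (t * z) + Cexp (- (t * z))) * 0).
- unfold Csinh; field; apply two_neq_0_C.
- apply (is_Cderive_mult (fun s => Cexp (s * z) + Cexp (- (s * z))) (fun _ => / 2)).
  + apply is_Cderive_plus; [apply is_Cderive_Cexp|apply is_Cderive_Cexp_opp].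
  + apply is_Cderive_const.
Qed.

Lemma is_Cderive_Csinh (z : C) (t : R) :
  is_Cderive (fun s => Csinh (s * z)) t (z * Ccosh (t * z)).
Proof.
apply is_Cderive_eq with
  ((z * Cexp (t * z) + - (1) * (- z * Cexp (- (t * z)))) * / 2
    + (Cexp (t * z) + - (1) * Cexp (- (t * z))) * 0).
- unfold Ccosh; field; apply two_neq_0_C.
- assert (H : is_Cderive (fun s => (Cexp (s * z) + - (1) * Cexp (- (s * z))) * / 2) t
    ((z * Cexp (t * z) + - (1) * (- z * Cexp (- (t * z)))) * / 2
    + (Cexp (t * z) + - (1) * Cexp (- (t * z))) * 0)).
  { apply (is_Cderive_mult (fun s => Cexp (s * z) + - (1) * Cexp (- (s * z))) (fun _ => / 2)).
    + apply is_Cderive_plus; [apply is_Cderive_Cexp|].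
      apply is_Cderive_scal, is_Cderive_Cexp_opp.
    + apply is_Cderive_const. }
  destruct H as [H1 H2]; split; [revert H1|revert H2]; apply is_derive_ext;
    intros s; f_equal; unfold Csinh; field; apply two_neq_0_C.
Qed.

Lemma Cmod_Ccosh_le (z : C) : (Cmod (Ccosh z) <= exp (Cmod z))%R.
Proof.
unfold Ccosh; rewrite Cmod_div, Cmod_R, Rabs_pos_eq by (lra || apply two_neq_0_C).
assert (H := Cmod_triangle (Cexp z) (Cexp (- z))).
assert (H1 := Cmod_Cexp_le z); assert (H2 := Cmod_Cexp_le (- z)).
rewrite Cmod_opp in H2; lra.
Qed.

Lemma exp_le_compat (x y : R) : (x <= y)%R -> (exp x <= exp y)%R.
Proof.
intros [H|H]; [left; now apply exp_increasing|right; now rewrite H].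
Qed.

Lemma Cmod_Rmult_le (z : C) (t T : R) :
  (0 <= t <= T)%R -> (Cmod (t * z) <= T * Cmod z)%R.
Proof.
intros Ht; rewrite Cmod_mult, Cmod_R, Rabs_pos_eq by lra.
apply Rmult_le_compat_r; [apply Cmod_ge_0|lra].
Qed.

(** [Csinh] vanishes at 0 and its derivative along the ray is bounded, so it grows at most
    linearly. *)
Lemma Cmod_Csinh_ray_le (z : C) (t T : R) :
  (0 <= t <= T)%R -> (Cmod (Csinh (t * z)) <= 2 * (Cmod z * exp (T * Cmod z)) * t)%R.
Proof.
intros Ht.
assert (H := MVT_Cmod_bound (fun s => Csinh (s * z)) (fun s => z * Ccosh (s * z)) t
  (Cmod z * exp (T * Cmod z))).
cbv beta in H; rewrite Cmult_0_l, Csinh_0 in H.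
unfold Cminus in H; rewrite Copp_0, Cplus_0_r in H.
apply H; [lra|]; intros s Hs; split; [apply is_Cderive_Csinh|].
rewrite Cmod_mult; apply Rmult_le_compat_l; [apply Cmod_ge_0|].
eapply Rle_trans; [apply Cmod_Ccosh_le|].
apply exp_le_compat, Cmod_Rmult_le; lra.
Qed.

(** The derivative [z Csinh (s z)] is already [O(s)], so a second mean value step gives [O(t^2)]; 4
    is the product of the two factors 2. *)
Lemma Cmod_Ccosh_minus_1_le (z : C) (t T : R) :
  (0 <= t <= T)%R ->
  (Cmod (Ccosh (t * z) - 1) <= 4 * (Cmod z ^ 2 * exp (T * Cmod z)) * t ^ 2)%R.
Proof.
intros Ht.
assert (H := MVT_Cmod_bound (fun s => Ccosh (s * z)) (fun s => z * Csinh (s * z)) t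
  (2 * (Cmod z ^ 2 * exp (T * Cmod z)) * t)).
cbv beta in H; rewrite Cmult_0_l, Ccosh_0 in H.
eapply Rle_trans; [apply H; [lra|]|right; simpl; ring].
intros s Hs; split; [apply is_Cderive_Ccosh|].
rewrite Cmod_mult.
assert (B := Cmod_Csinh_ray_le z s T ltac:(lra)).
assert (P := Cmod_ge_0 z); assert (Q := exp_pos (T * Cmod z)).
apply Rle_trans with (Cmod z * (2 * (Cmod z * exp (T * Cmod z)) * s))%R.
- now apply Rmult_le_compat_l.
- replace (Cmod z * (2 * (Cmod z * exp (T * Cmod z)) * s))%R
    with (2 * (Cmod z ^ 2 * exp (T * Cmod z)) * s)%R by ring.
  apply Rmult_le_compat_l; [|lra]. simpl; nra.
Qed.

(** * Dirichlet and Fejer kernels *)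

(** [1 - cos t = 2 sin^2 (t / 2)], and [sin u >= u - u^3 / 6] at [u = t / 2] with [t <= 4] gives
    [sin (t / 2) >= t / 6]. *)
Lemma one_minus_cos_ge (t : R) : (0 <= t <= PI)%R -> (t ^ 2 / 18 <= 1 - cos t)%R.
Proof.
intros Ht; assert (P4 := PI_4).
replace (cos t) with (cos (2 * (t / 2))) by (f_equal; field).
rewrite cos_2a_sin.
assert (H := proj1 (sin_bound (t / 2) 0 ltac:(lra) ltac:(lra))).
unfold sin_approx, sin_term in H; simpl in H.
assert (S : (t / 6 <= sin (t / 2))%R).
{ eapply Rle_trans; [|apply H].
  assert (H4 : (t * t <= 16)%R) by nra.
  assert (0 <= t * (16 - t * t))%R by nra. lra. }
nra.
Qed.

Fixpoint dirichlet (n : nat) (t : R) : R :=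
  match n with
  | O => 1
  | S k => dirichlet k t + 2 * cos (INR (S k) * t)
  end.

(** With the factor [1 - cos t] the right-hand side is a difference of consecutive terms, so summing
    over [n] telescopes to the Fejer kernel, and no division fails at [t = 0]. *)
Lemma dirichlet_mult (n : nat) (t : R) :
  (dirichlet n t * (1 - cos t) = cos (INR n * t) - cos (INR (S n) * t))%R.
Proof.
induction n as [|n IH].
- simpl; rewrite Rmult_0_l, cos_0, !Rmult_1_l; ring.
- change (dirichlet (S n) t) with (dirichlet n t + 2 * cos (INR (S n) * t))%R; rewrite Rmult_plus_distr_r, IH.
  replace (INR n * t)%R with (INR (S n) * t - t)%R by (rewrite S_INR; ring).
  replace (INR (S (S n)) * t)%R with (INR (S n) * t + t)%R
    by (rewrite (S_INR (S n)); ring).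
  rewrite cos_plus, cos_minus; ring.
Qed.

Lemma fejer_mult (n : nat) (t : R) :
  (sum_n (fun k => dirichlet k t) n * (1 - cos t) = 1 - cos (INR (S n) * t))%R.
Proof.
induction n as [|n IH].
- rewrite sum_O, dirichlet_mult; simpl INR; rewrite Rmult_0_l, cos_0; ring.
- rewrite sum_Sn; match goal with |- context [plus ?p ?q] => change (plus p q) with (p + q)%R end.
  rewrite Rmult_plus_distr_r, IH, dirichlet_mult; ring.
Qed.

Lemma fejer_bound (z : C) (n : nat) (t : R) :
  (0 <= t <= PI)%R ->
  (Cmod ((Ccosh (t * z) - 1) * sum_n (fun k => dirichlet k t) n)
    <= 144 * (Cmod z ^ 2 * exp (PI * Cmod z)))%R.
Proof.
intros Ht.
assert (P := Cmod_ge_0 z); assert (Q := exp_pos (PI * Cmod z)).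
set (K := (Cmod z ^ 2 * exp (PI * Cmod z))%R).
assert (HK : (0 <= K)%R) by (unfold K; apply Rmult_le_pos; [apply pow_le|]; lra).
assert (B := Cmod_Ccosh_minus_1_le z t PI Ht); fold K in B.
rewrite Cmod_mult, Cmod_R.
generalize (fejer_mult n t); generalize (sum_n (fun k => dirichlet k t) n).
change (forall F : R, (F * (1 - cos t) = 1 - cos (INR (S n) * t))%R ->
  (Cmod (Ccosh (t * z) - 1) * Rabs F <= 144 * K)%R); intros F HF.
assert (C1 := COS_bound (INR (S n) * t)).
assert (C2 := one_minus_cos_ge t Ht).
(* At [t = 0] the identity says nothing about [F], but the other factor is 0. *)
destruct (Req_dec t 0) as [->|Hz].
- replace (Cmod _) with 0%R; [|rewrite Cmult_0_l, Ccosh_0; unfold Cminus; rewrite Cplus_opp_r; now rewrite Cmod_0].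
  rewrite Rmult_0_l; lra.
- assert (T2 : (0 < t ^ 2)%R) by (apply pow_lt; lra).
  assert (F0 : (0 <= F)%R) by (apply Rmult_le_reg_r with (1 - cos t)%R; lra).
  rewrite Rabs_pos_eq by auto.
  (* From [F (1 - cos t) <= 2] and [1 - cos t >= t^2 / 18]; then [144 = 4 * 36]. *)
  assert (F1 : (F * t ^ 2 <= 36)%R) by nra.
  apply Rle_trans with (4 * K * t ^ 2 * F)%R.
  + now apply Rmult_le_compat_r.
  + nra.
Qed.

(** The antiderivative of [(Ccosh (t * z) - 1) * dirichlet n t] that vanishes at [0]. *)
Fixpoint dirichlet_prim (z : C) (n : nat) (t : R) : C :=
  match n with
  | O => / z * Csinh (t * z) + - (1) * t
  | S k => dirichlet_prim z k t +
      (2 / (z ^ 2 + INR (S k) ^ 2) *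
        (z * (Csinh (t * z) * cos (INR (S k) * t)) +
         INR (S k) * (Ccosh (t * z) * sin (INR (S k) * t)))
       + - (2 / INR (S k)) * sin (INR (S k) * t))
  end.

(** The zeros [z = +- i m] lie on the imaginary axis. *)
Lemma sqr_plus_sqr_neq_0 (z : C) (m : R) :
  (0 < Re z)%R -> z ^ 2 + m ^ 2 <> 0.
Proof.
destruct z as [u v]; simpl; intros Hu E.
assert (E1 := f_equal Re E); assert (E2 := f_equal Im E); simpl in E1, E2.
ring_simplify in E1; ring_simplify in E2.
assert (Hv : v = 0%R).
{ destruct (Rmult_integral (2 * u) v); lra. }
subst v; nra.
Qed.

Lemma Re_pos_neq_0 (z : C) : (0 < Re z)%R -> z <> 0.
Proof. intros H ->; simpl in H; lra. Qed.

Lemma is_Cderive_dirichlet_prim (z : C) (n : nat) (t : R) :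
  (0 < Re z)%R ->
  is_Cderive (dirichlet_prim z n) t ((Ccosh (t * z) - 1) * dirichlet n t).
Proof.
intros Hz; assert (Hz0 := Re_pos_neq_0 z Hz).
induction n as [|n IH].
- apply is_Cderive_eq with (/ z * (z * Ccosh (t * z)) + - (1) * 1).
  + simpl; field; auto.
  + apply is_Cderive_plus; apply is_Cderive_scal; [apply is_Cderive_Csinh|].
    apply is_Cderive_RtoC, (is_derive_id (K := R_AbsRing)).
- set (m := INR (S n)).
  assert (Hm : m <> 0%R) by (apply not_0_INR; discriminate).
  assert (Hc : is_Cderive (fun s => RtoC (cos (m * s))) t (RtoC (- m * sin (m * t)))).
  { apply is_Cderive_RtoC; auto_derive; auto; ring. }
  assert (Hs : is_Cderive (fun s => RtoC (sin (m * s))) t (RtoC (m * cos (m * t)))).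
  { apply is_Cderive_RtoC; auto_derive; auto; ring. }
  assert (Hn := sqr_plus_sqr_neq_0 z m Hz).
  eapply is_Cderive_eq; [|exact (is_Cderive_plus _ _ t _ _ IH
    (is_Cderive_plus _ _ t _ _
      (is_Cderive_scal (2 / (z ^ 2 + m ^ 2)) _ t _ (is_Cderive_plus _ _ t _ _
        (is_Cderive_scal z _ t _ (is_Cderive_mult _ _ t _ _ (is_Cderive_Csinh z t) Hc))
        (is_Cderive_scal m _ t _ (is_Cderive_mult _ _ t _ _ (is_Cderive_Ccosh z t) Hs))))
      (is_Cderive_scal (- (2 / m)) _ t _ Hs)))].
  change (dirichlet (S n) t) with (dirichlet n t + 2 * cos (INR (S n) * t))%R; fold m; rewrite RtoC_plus, !RtoC_mult, RtoC_opp; field.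
  split; auto.
  intros E; apply RtoC_inj in E; auto.
Qed.

Lemma dirichlet_prim_0 (z : C) (n : nat) : dirichlet_prim z n 0 = 0.
Proof.
induction n as [|n IH]; cbn [dirichlet_prim].
- rewrite Cmult_0_l, Csinh_0; ring.
- rewrite IH, Cmult_0_l, Csinh_0, Rmult_0_r, sin_0; ring.
Qed.

(** The sum of [(-1)^k / (z^2 + k^2)] over [-n <= k <= n], with [k] and [-k] paired. *)
Fixpoint csch_partial (z : C) (n : nat) : C :=
  match n with
  | O => / z ^ 2
  | S k => csch_partial z k + 2 * ((- (1)) ^ S k / (z ^ 2 + INR (S k) ^ 2))
  end.

Lemma sin_INR_PI (n : nat) : sin (INR n * PI) = 0%R.
Proof.
rewrite INR_IZR_INZ, sin_eq_0_1; auto; now exists (Z.of_nat n).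
Qed.

Lemma cos_INR_PI (n : nat) : RtoC (cos (INR n * PI)) = (- (1)) ^ n.
Proof.
induction n as [|n IH].
- simpl; now rewrite Rmult_0_l, cos_0.
- rewrite Cpow_S, <- IH, S_INR, Rmult_plus_distr_r, Rmult_1_l, neg_cos, RtoC_opp; ring.
Qed.

(** At [PI] the sines vanish and [cos (k PI) = (-1)^k]. The value is the integral of
    [(Ccosh (t z) - 1) D_n(t)] over [[0, PI]], that is, the error of the Fourier partial sum at 0 up
    to a constant factor. *)
Lemma dirichlet_prim_PI (z : C) (n : nat) :
  (0 < Re z)%R ->
  dirichlet_prim z n PI = z * Csinh (PI * z) * csch_partial z n - PI.
Proof.
intros Hz; assert (Hz0 := Re_pos_neq_0 z Hz).
induction n as [|n IH]; [simpl; field; auto|].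
cbn [dirichlet_prim csch_partial].
  rewrite IH, sin_INR_PI, cos_INR_PI, Cpow_S.
  unfold Cdiv; ring.
Qed.

(** Otherwise the sums would grow linearly. *)
Lemma lim_0_of_bounded_sums (u : nat -> C) (l : C) (M : R) :
  is_lim_seq (fun n => Cmod (u n - l)) 0 ->
  (forall n, (Cmod (sum_n u n) <= M)%R) -> l = 0.
Proof.
intros H HM; apply Cmod_eq_0.
destruct (Rle_lt_or_eq_dec _ _ (Cmod_ge_0 l)) as [Hl|Hl]; [exfalso|auto].
apply is_lim_seq_spec in H.
destruct (H (mkposreal (Cmod l / 2) ltac:(lra))) as [N HN]; simpl in HN.
assert (G : forall k, (Cmod (sum_n u (N + k) - sum_n u N - INR k * l) <= INR k * (Cmod l / 2))%R).
{ induction k as [|k IH].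
  - rewrite Nat.add_0_r; simpl.
    replace (sum_n u N - sum_n u N - 0 * l) with (RtoC 0) by cring.
    rewrite Cmod_0; lra.
  - rewrite Nat.add_succ_r, sum_n_S, S_INR, RtoC_plus.
    specialize (HN (S (N + k)) ltac:(lia)).
    rewrite Rminus_0_r, Rabs_pos_eq in HN by apply Cmod_ge_0.
    replace (sum_n u (N + k) + u (S (N + k)) - sum_n u N - (INR k + 1) * l)
      with (sum_n u (N + k) - sum_n u N - INR k * l + (u (S (N + k)) - l)) by cring.
    eapply Rle_trans; [apply Cmod_triangle|lra]. }
(* With [k + 1 > 4 M / |l|], the bound [(k + 1) |l| / 2 <= 2 M] obtained below is violated. *)
destruct (nfloor_ex (4 * M / Cmod l)) as [k [_ Hk]].
{ apply Rmult_le_pos; [|left; apply Rinv_0_lt_compat; auto].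
  assert (P := HM O); assert (P' := Cmod_ge_0 (sum_n u 0)); lra. }
specialize (G (S k)).
assert (T : (INR (S k) * Cmod l <= 2 * M + INR (S k) * (Cmod l / 2))%R).
{ rewrite <- (Rabs_pos_eq (INR (S k))) at 1 by apply pos_INR.
  rewrite <- Cmod_R, <- Cmod_mult.
  replace (INR (S k) * l) with (sum_n u (N + S k) + - (sum_n u N)
    + - (sum_n u (N + S k) - sum_n u N - INR (S k) * l)) by cring.
  eapply Rle_trans; [apply Cmod_triangle|]; rewrite Cmod_opp.
  apply Rplus_le_compat; auto.
  eapply Rle_trans; [apply Cmod_triangle|]; rewrite Cmod_opp.
  assert (P1 := HM N); assert (P2 := HM (N + S k)%nat); lra. }
rewrite S_INR in T.
apply (Rmult_lt_compat_r (Cmod l)) in Hk; auto.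
replace (4 * M / Cmod l * Cmod l)%R with (4 * M)%R in Hk by (field; lra).
lra.
Qed.

(** The errors [c csch_partial z n - PI] converge to [c S - PI], and their sums over [n] are bounded
    by the Fejer estimate, so this limit is 0. In [M], the factor 2 comes from the mean value
    inequality and [PI] is the length of the interval. *)
Lemma csch_expansion (z S : C) :
  (0 < Re z)%R ->
  is_lim_seq (fun n => Cmod (csch_partial z n - S)) 0 ->
  z * Csinh (PI * z) * S = PI.
Proof.
intros Hz HS.
set (c := z * Csinh (PI * z)).
assert (E : c * S - PI = 0).
{ apply lim_0_of_bounded_sums with (u := fun n => c * csch_partial z n - PI)
    (M := (2 * (144 * (Cmod z ^ 2 * exp (PI * Cmod z))) * PI)%R).
  - apply is_lim_seq_ext with (fun n => Cmod c * Cmod (csch_partial z n - S))%R.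
    + intros n; rewrite <- Cmod_mult; f_equal; ring.
    + replace (Finite 0) with (Rbar_mult (Cmod c) 0) by (simpl; f_equal; ring).
      now apply is_lim_seq_scal_l.
  - intros n.
    assert (H := MVT_Cmod_bound (fun t => sum_n (fun k => dirichlet_prim z k t) n)
      (fun t => (Ccosh (t * z) - 1) * sum_n (fun k => dirichlet k t) n) PI
      (144 * (Cmod z ^ 2 * exp (PI * Cmod z))) (Rlt_le _ _ PI_RGT_0)).
    cbv beta in H.
    replace (sum_n (fun n => c * csch_partial z n - PI) n)
      with (sum_n (fun k => dirichlet_prim z k PI) n - sum_n (fun k => dirichlet_prim z k 0) n).
    2:{ rewrite <- sum_n_minus_C; apply sum_n_ext_C; intros k _.
        rewrite dirichlet_prim_0, dirichlet_prim_PI by auto; unfold c; ring. }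
    apply H; intros t Ht; split; [|now apply fejer_bound].
    clear H Ht; induction n as [|n IH].
    + rewrite sum_O; destruct (is_Cderive_dirichlet_prim z 0 t Hz) as [H1 H2]; split;
        [revert H1|revert H2]; apply is_derive_ext; intros s; now rewrite sum_O.
    + rewrite sum_Sn; change (plus ?p ?q) with (p + q)%R.
      rewrite RtoC_plus, Cmult_plus_distr_l.
      destruct (is_Cderive_plus _ _ t _ _ IH (is_Cderive_dirichlet_prim z (Datatypes.S n) t Hz))
        as [H1 H2]; split;
        [revert H1|revert H2]; apply is_derive_ext; intros s; now rewrite sum_n_S. }
replace (c * S) with (c * S - PI + PI) by ring; rewrite E; ring.
Qed.

(** * The inner sum *)

(** Telescoping: [1 / (y + 1)^2 <= 1 / y - 1 / (y + 1)] keeps the partial sums below 2. *)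
Lemma ex_series_inv_sqr : ex_series (fun k => / INR (S k) ^ 2)%R.
Proof.
assert (H : forall n, (sum_n (fun k => / INR (S k) ^ 2)%R n <= 2 - / INR (S n))%R).
{ induction n as [|n IH].
  - rewrite sum_O; simpl; lra.
  - rewrite sum_Sn; match goal with |- (plus ?p ?q <= _)%R => change (p + q <= 2 - / INR (S (S n)))%R end.
    rewrite (S_INR (S n)).
    assert (P : (1 <= INR (S n))%R) by (rewrite S_INR; assert (Q := pos_INR n); lra).
    revert IH P; generalize (INR (S n)); intros y IH P.
    assert (E : (/ y - / (y + 1) = / (y * (y + 1)))%R) by (field; lra).
    assert (B : (/ (y + 1) ^ 2 <= / (y * (y + 1)))%R) by (apply Rinv_le_contravar; nra).
    apply Rle_trans with (2 - / y + / (y + 1) ^ 2)%R; [|lra].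
    now apply Rplus_le_compat_r. }
destruct (ex_finite_lim_seq_incr (sum_n (fun k => / INR (S k) ^ 2)%R) 2) as [l Hl].
- intros n; rewrite sum_Sn.
  match goal with |- (_ <= plus ?p ?q)%R => change (p <= p + q)%R end.
  assert (D : (0 < / INR (S (S n)) ^ 2)%R).
  { apply Rinv_0_lt_compat, pow_lt, lt_0_INR; lia. }
  lra.
- intros n; specialize (H n).
  assert (P : (0 < / INR (S n))%R) by (apply Rinv_0_lt_compat, lt_0_INR; lia).
  lra.
- now exists l.
Qed.

(** Write [k + 1 = (k - |w|) + (|w| + 1)]: the first part is at most [|k + w|], the second is a
    fixed multiple of [|Im w| <= |k + w|]. *)
Lemma Cmod_INR_plus_ge (w : C) (k : nat) :
  Im w <> 0%R ->
  (INR (S k) <= (1 + (Cmod w + 1) / Rabs (Im w)) * Cmod (INR k + w))%R.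
Proof.
intros Hw; assert (P := Rabs_pos_lt _ Hw).
assert (H1 : (Rabs (Im w) <= Cmod (INR k + w))%R).
{ eapply Rle_trans; [|apply im_le_Cmod]; change (Im (INR k + w)) with (0 + Im w)%R; rewrite Rplus_0_l; lra. }
assert (H2 := Cmod_ge_minus (INR k) w).
rewrite Cmod_R, (Rabs_pos_eq (INR k)) in H2 by apply pos_INR.
assert (H3 : (Cmod w + 1 <= (Cmod w + 1) / Rabs (Im w) * Cmod (INR k + w))%R).
{ replace (Cmod w + 1)%R with ((Cmod w + 1) / Rabs (Im w) * Rabs (Im w))%R at 1
    by (field; lra).
  apply Rmult_le_compat_l; auto.
  assert (Q := Cmod_ge_0 w); apply Rlt_le, Rdiv_lt_0_compat; lra. }
rewrite S_INR; lra.
Qed.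

(** [z^2 + k^2 = (k + i z)(k - i z)], and [+- i z] has imaginary part [+- Re z], nonzero; so each
    factor is at least [(k + 1) / c]. *)
Lemma ex_series_Cmod_csch (z : C) :
  (0 < Re z)%R ->
  ex_series (fun k => Cmod ((- (1)) ^ k / (z ^ 2 + INR k ^ 2))).
Proof.
intros Hz.
set (c := (1 + (Cmod z + 1) / Re z)%R).
apply ex_series_Cmod_le with (fun k => c ^ 2 * / INR (S k) ^ 2)%R.
2:{ apply (ex_series_scal (V := R_NormedModule) (c ^ 2)%R), ex_series_inv_sqr. }
intros k; assert (Hn := sqr_plus_sqr_neq_0 z (INR k) Hz).
rewrite Cmod_div, Cmod_pow, Cmod_m1, pow1 by auto.
assert (B : forall w, Rabs (Im w) = Re z -> Cmod w = Cmod z ->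
  (INR (S k) <= c * Cmod (INR k + w))%R).
{ intros w E1 E2; unfold c; rewrite <- E1, <- E2; apply Cmod_INR_plus_ge.
  intros E; rewrite E, Rabs_R0 in E1; lra. }
assert (B1 := B (Ci * z)); assert (B2 := B (- (Ci * z))).
rewrite Cmod_opp, Cmod_mult, Cmod_Ci, Rmult_1_l in *.
assert (EI : Im (Ci * z) = Re z) by (destruct z; simpl; ring).
specialize (B1 ltac:(rewrite EI, Rabs_pos_eq; lra) eq_refl).
specialize (B2 ltac:(change (Im (- (Ci * z))) with (- Im (Ci * z))%R; rewrite EI, Rabs_Ropp, Rabs_pos_eq; lra) eq_refl).
assert (I : (0 < INR (S k))%R) by (apply lt_0_INR; lia).
assert (E : z ^ 2 + INR k ^ 2 = (INR k + Ci * z) * (INR k + - (Ci * z))).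
{ replace (z ^ 2 + INR k ^ 2) with (INR k ^ 2 - Ci * Ci * z ^ 2); [ring|].
  replace (Ci * Ci) with (- (1) : C) by (apply C_ext; simpl; ring); ring. }
assert (F : (INR (S k) ^ 2 <= c ^ 2 * Cmod (z ^ 2 + INR k ^ 2))%R).
{ rewrite E, Cmod_mult; apply Rle_trans with
   ((c * Cmod (INR k + Ci * z)) * (c * Cmod (INR k + - (Ci * z))))%R; [|right; ring].
  replace (INR (S k) ^ 2)%R with (INR (S k) * INR (S k))%R by ring.
  apply Rmult_le_compat; lra. }
assert (M : (0 < Cmod (z ^ 2 + INR k ^ 2))%R) by now apply Cmod_gt_0.
assert (I2 : (0 < INR (S k) ^ 2)%R) by now apply pow_lt.
apply (Rmult_le_reg_r (INR (S k) ^ 2 * Cmod (z ^ 2 + INR k ^ 2))); [now apply Rmult_lt_0_compat|].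
replace (1 / Cmod (z ^ 2 + INR k ^ 2) * (INR (S k) ^ 2 * Cmod (z ^ 2 + INR k ^ 2)))%R
  with (INR (S k) ^ 2)%R by (field; lra).
replace (c ^ 2 * / INR (S k) ^ 2 * (INR (S k) ^ 2 * Cmod (z ^ 2 + INR k ^ 2)))%R
  with (c ^ 2 * Cmod (z ^ 2 + INR k ^ 2))%R by (field; lra).
exact F.
Qed.

Lemma csch_partial_sum_n (z : C) (n : nat) :
  csch_partial z n =
  2 * sum_n (fun k => (- (1)) ^ k / (z ^ 2 + INR k ^ 2)) n - / z ^ 2.
Proof.
induction n as [|n IH].
- rewrite sum_O; replace (z ^ 2 + INR 0 ^ 2) with (z ^ 2) by (simpl; ring).
  cbn [csch_partial Cpow]; unfold Cdiv; ring.
- cbn [csch_partial]; rewrite IH, sum_n_S; cring.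
Qed.

(** One-sided form of [sum_m (-1)^m / (z^2 + m^2) = PI / (z sinh (PI z))]. *)
Lemma csch_series (z : C) :
  (0 < Re z)%R ->
  exists s : C,
    is_series (fun k => (- (1)) ^ k / (z ^ 2 + INR k ^ 2)) s /\
    z * Csinh (PI * z) * (2 * s - / z ^ 2) = PI.
Proof.
intros Hz.
destruct (ex_series_C _ (ex_series_Cmod_csch z Hz)) as [s Hs].
exists s; split; auto.
apply csch_expansion; auto.
apply is_series_C_iff in Hs.
apply (is_lim_seq_scal_l _ 2) in Hs.
replace (Rbar_mult 2 0) with (Finite 0) in Hs by (simpl; f_equal; ring).
revert Hs; apply is_lim_seq_ext; intros n.
transitivity (Cmod (2 * (sum_n (fun k => (- (1)) ^ k / (z ^ 2 + INR k ^ 2)) n - s))).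
- rewrite Cmod_mult, Cmod_R, (Rabs_pos_eq 2) by lra; reflexivity.
- rewrite csch_partial_sum_n; f_equal; cring.
Qed.

Lemma Cm1_Cexp : RtoC (-1) = Cexp (PI * Ci).
Proof.
apply C_ext; unfold Cexp; simpl;
  rewrite ?Rmult_0_r, ?Rmult_0_l, ?Rminus_0_r, ?Rmult_1_r, ?Rplus_0_r, exp_0, ?Rplus_0_l, ?cos_PI, ?sin_PI; ring.
Qed.

Lemma CpowZ_Cexp_add (z : C) (k l : Z) :
  CpowZ (Cexp z) (k + l) = CpowZ (Cexp z) k * CpowZ (Cexp z) l.
Proof.
rewrite !CpowZ_Cexp, <- Cexp_add, plus_IZR, RtoC_plus; f_equal; ring.
Qed.

Lemma CpowZ_m1_add (k l : Z) : CpowZ (-1) (k + l) = CpowZ (-1) k * CpowZ (-1) l.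
Proof. rewrite Cm1_Cexp; apply CpowZ_Cexp_add. Qed.

Lemma CpowZ_of_nat (z : C) (k : nat) : CpowZ z (Z.of_nat k) = z ^ k.
Proof. destruct k as [|k]; auto; simpl; now rewrite SuccNat2Pos.id_succ. Qed.

Lemma CpowZ_m1_opp (k : Z) : CpowZ (-1) (- k) = CpowZ (-1) k.
Proof.
rewrite Cm1_Cexp, !CpowZ_Cexp.
replace (IZR k * (PI * Ci)) with (IZR (- k) * (PI * Ci) + IZR (2 * k) * (PI * Ci)).
- rewrite Cexp_add.
  replace (Cexp (IZR (2 * k) * _)) with (RtoC 1); [ring|].
  rewrite <- CpowZ_Cexp, <- Cm1_Cexp.
  destruct k as [|p|p]; simpl CpowZ; auto; rewrite Pos2Nat.inj_xO, Cpow_mult_r;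
    replace ((-1) ^ 2) with (RtoC 1) by (apply C_ext; simpl; ring);
    rewrite Cpow_1_l; auto.
  apply C_ext; simpl; field.
- rewrite opp_IZR, mult_IZR, RtoC_opp, RtoC_mult; ring.
Qed.

(** The coefficient of [V r] when [sum_m sum_r V r q^((2m+1) r) / r] is summed over [m] first. *)
Definition lambert_coef (q : C) (r : nat) : C :=
  q ^ r / (INR r * (1 - q ^ (2 * r))).

Lemma inv_Re_pos (x : C) : (0 < Re x)%R -> (0 < Re (/ x))%R.
Proof.
destruct x as [u v]; simpl; intros Hu; apply Rdiv_lt_0_compat; nra.
Qed.

Lemma Cmod_nome_lt_1 (x : C) : (0 < Re x)%R -> (Cmod (nome x) < 1)%R.
Proof.
intros Hx; unfold nome; rewrite Cmod_Cexp, <- exp_0; apply exp_increasing.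
assert (H := inv_Re_pos x Hx); assert (P := PI_RGT_0).
replace (Re (- PI / x)) with (- (PI * Re (/ x)))%R; [nra|].
unfold Cdiv; rewrite <- RtoC_opp; destruct (/ x); simpl; ring.
Qed.

Lemma F_term_inner_sum (a b : Z) (x : C) (n : Z) :
  (0 < Re x)%R -> (a * n + b <> 0)%Z ->
  is_abs_sum_Z (F_term a b x n)
    (2 * PI / x * (CpowZ (-1) n * lambert_coef (nome x) (Z.abs_nat (a * n + b)))).
Proof.
intros Hx Hc.
set (r := Z.abs_nat (a * n + b)).
assert (Hr : (0 < INR r)%R) by (apply lt_0_INR; unfold r; lia).
assert (HrC : RtoC (INR r) <> 0) by (intros E; apply RtoC_inj in E; lra).
assert (Hx0 := Re_pos_neq_0 x Hx).
set (z := INR r / x).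
assert (Hz : (0 < Re z)%R).
{ assert (H := inv_Re_pos x Hx); unfold z, Cdiv; destruct (/ x); simpl in *; nra. }
assert (Hz0 := Re_pos_neq_0 z Hz).
set (c := CpowZ (-1) n / x ^ 2).
(* The term is even in [m], so both halves of the inner sum reduce to the one-sided series at
   [z = r / x]. *)
assert (T : forall k : nat,
  F_term a b x n (Z.of_nat k) = c * ((- (1)) ^ k / (z ^ 2 + INR k ^ 2)) /\
  F_term a b x n (- Z.of_nat k) = c * ((- (1)) ^ k / (z ^ 2 + INR k ^ 2))).
{ intros k.
  assert (S1 : RtoC (IZR (a * n + b)) ^ 2 = INR r ^ 2).
  { unfold r; rewrite INR_IZR_INZ, Zabs2Nat.id_abs, abs_IZR.
    rewrite <- !RtoC_pow; f_equal; now rewrite <- Rsqr_pow2, <- Rsqr_pow2, <- Rsqr_abs. }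
  assert (D : (x * INR k) ^ 2 + INR r ^ 2 = x ^ 2 * (z ^ 2 + INR k ^ 2)).
  { unfold z; field; auto. }
  assert (N := sqr_plus_sqr_neq_0 z (INR k) Hz).
  unfold F_term, c; rewrite S1, !CpowZ_m1_add, CpowZ_m1_opp, CpowZ_of_nat.
  rewrite opp_IZR, RtoC_opp, <- INR_IZR_INZ.
  replace (x * - INR k) with (- (x * INR k)) by ring.
  replace ((- (x * INR k)) ^ 2) with ((x * INR k) ^ 2) by ring.
  rewrite D; replace (RtoC (-1)) with (- (1) : C) by (apply C_ext; simpl; ring).
  split; field; split; auto. }
assert (A := ex_series_Cmod_csch z Hz).
assert (A' : ex_series (fun k => Cmod (c * ((- (1)) ^ k / (z ^ 2 + INR k ^ 2))))).
{ apply (ex_series_ext (fun k => Cmod c * Cmod ((- (1)) ^ k / (z ^ 2 + INR k ^ 2)))%R).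
  - intros k; symmetry; apply Cmod_mult.
  - now apply (ex_series_scal (V := R_NormedModule)). }
destruct (csch_series z Hz) as [s [Hs Es]].
split; [|split].
- revert A'; apply ex_series_ext; intros k; now rewrite (proj1 (T k)).
- apply (ex_series_incr_1 (V := R_NormedModule)) in A'.
  revert A'; apply ex_series_ext; intros k; now rewrite (proj2 (T (S k))).
- exists (c * s), (c * (s - / z ^ 2)); split; [|split].
  + apply (is_series_scal_C c) in Hs; revert Hs; apply is_series_ext_C.
    intros k; symmetry; apply T.
  + apply is_series_ext_C with (fun k => c * ((- (1)) ^ S k / (z ^ 2 + INR (S k) ^ 2))).
    * intros k; symmetry; apply (T (S k)).
    * apply (is_series_scal_C c).
      apply (is_series_incr_1 (V := C_NormedModule) (fun k => (- (1)) ^ k / (z ^ 2 + INR k ^ 2))).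
      match goal with |- is_series _ ?l => replace l with s; auto end.
      match goal with |- _ = plus ?p ?q => change (plus p q) with (p + q) end.
      simpl; field; auto.
  + set (Q := nome x ^ r).
    assert (EQ : Q = Cexp (- (PI * z))).
    { unfold Q, nome, z; rewrite Cexp_pow; f_equal; field; auto. }
    assert (EQ' : Cexp (PI * z) = / Q) by (rewrite EQ, Cexp_opp; field; apply Cexp_neq_0).
    assert (Q0 : Q <> 0) by (rewrite EQ; apply Cexp_neq_0).
    (* The expansion itself shows this: otherwise its left-hand side would be 0 instead of [PI]. *)
    assert (Q1 : 1 - Q ^ 2 <> 0).
    { intros E.
      unfold Csinh in Es; rewrite <- EQ, EQ' in Es.
      replace (z * ((/ Q - Q) / 2) * (2 * s - / z ^ 2)) with
        ((1 - Q ^ 2) * (z / (2 * Q) * (2 * s - / z ^ 2))) in Es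
        by (field; repeat split; auto using two_neq_0_C).
      rewrite E, Cmult_0_l in Es; apply RtoC_inj in Es.
      assert (P := PI_RGT_0); lra. }
    assert (Es' : 2 * s - / z ^ 2 = PI * (2 * Q / (z * (1 - Q ^ 2)))).
    { rewrite <- Es; unfold Csinh; rewrite <- EQ, EQ'; field; repeat split; auto using two_neq_0_C. }
    replace (c * s + c * (s - / z ^ 2)) with (c * (2 * s - / z ^ 2)) by ring.
    rewrite Es'; unfold lambert_coef.
    replace (nome x ^ (2 * r)) with (Q ^ 2) by (unfold Q; rewrite <- Cpow_mult_r; f_equal; lia).
    fold Q; unfold c, z; field; repeat split; auto.
Qed.

(** * Roots of -1 and Lambert series *)

Lemma RtoC_IZR_neq_0 (a : Z) : (a <> 0)%Z -> RtoC (IZR a) <> 0.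
Proof. intros Ha E; apply RtoC_inj in E; now apply eq_IZR in E. Qed.

Lemma CpowZ_Cexp_pow (z : C) (k : Z) (n : nat) :
  CpowZ (Cexp z) k ^ n = CpowZ (Cexp z) (k * Z.of_nat n).
Proof.
rewrite !CpowZ_Cexp, Cexp_pow, mult_IZR, RtoC_mult, <- INR_IZR_INZ; f_equal; ring.
Qed.

Lemma CpowZ_omega (a k : Z) :
  (a <> 0)%Z -> CpowZ (omega a) k = Cexp ((IZR k * PI / IZR a)%R * Ci).
Proof.
intros Ha; unfold omega; rewrite CpowZ_Cexp; f_equal.
assert (H := RtoC_IZR_neq_0 a Ha).
rewrite RtoC_div, RtoC_mult by now apply not_0_IZR.
field; auto.
Qed.

Lemma Cmod_CpowZ_omega (a k : Z) : (a <> 0)%Z -> Cmod (CpowZ (omega a) k) = 1%R.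
Proof.
intros Ha; rewrite CpowZ_omega, Cmod_Cexp, <- exp_0 by auto; f_equal; simpl; ring.
Qed.

Lemma CpowZ_omega_mult (a n : Z) :
  (a <> 0)%Z -> CpowZ (omega a) (a * n) = CpowZ (-1) n.
Proof.
intros Ha; unfold omega; rewrite Cm1_Cexp, !CpowZ_Cexp, mult_IZR, RtoC_mult; f_equal.
assert (H := RtoC_IZR_neq_0 a Ha); field; auto.
Qed.

(** The real part suffices: [cos (2 y) = 1] with [y = k PI / a] forces [sin y = 0], so [y] is a
    multiple of [PI]. *)
Lemma CpowZ_omega_eq_1 (a k : Z) :
  (a <> 0)%Z -> CpowZ (omega a) (2 * k) = 1 -> (a | k)%Z.
Proof.
intros Ha E; rewrite CpowZ_omega in E by auto.
apply (f_equal Re) in E; unfold Cexp in E.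
assert (Ha' : IZR a <> 0%R) by now apply not_0_IZR.
set (y := (IZR k * PI / IZR a)%R).
assert (C : cos (2 * y) = 1%R).
{ rewrite mult_IZR in E.
  replace (2 * y)%R with (Im (RtoC (2 * IZR k * PI / IZR a) * Ci))
    by (unfold y; simpl; field; auto).
  replace (Re (RtoC (2 * IZR k * PI / IZR a) * Ci)) with 0%R in E by (simpl; ring).
  rewrite exp_0 in E; change (1 * cos (Im (RtoC (2 * IZR k * PI / IZR a) * Ci)) = 1)%R in E.
  lra. }
rewrite cos_2a_sin in C.
destruct (sin_eq_0_0 y) as [m Hm]; [nra|].
exists m; apply eq_IZR; rewrite mult_IZR.
assert (P := PI_RGT_0).
unfold y in Hm; apply Rmult_eq_reg_r with (PI / IZR a)%R.
- replace (IZR k * (PI / IZR a))%R with (IZR k * PI / IZR a)%R by (field; auto).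
  rewrite Hm; field; auto.
- apply Rmult_integral_contrapositive; split; [lra|now apply Rinv_neq_0_compat].
Qed.

Lemma CpowZ_m1_even (k : Z) : CpowZ (-1) (2 * k) = 1.
Proof.
replace (2 * k)%Z with (k + k)%Z by ring.
rewrite CpowZ_m1_add; rewrite <- (CpowZ_m1_opp k) at 1.
rewrite <- CpowZ_m1_add; now replace (- k + k)%Z with 0%Z by ring.
Qed.

Lemma sum_n_const_C (c : C) (n : nat) : sum_n (fun _ => c) n = INR (S n) * c.
Proof.
induction n as [|n IH]; [rewrite sum_O; simpl; cring|].
rewrite sum_n_S, IH, (S_INR (S n)), RtoC_plus; cring.
Qed.

(** The sum of [zeta^k] over the [a]-th roots [zeta] of [-1]. *)
Definition root_sum (a k : Z) : C :=
  sum_n (fun j => CpowZ (omega a) ((2 * Z.of_nat j + 1) * k)) (Z.to_nat a - 1).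

Lemma root_sum_multiple (a n : Z) :
  (0 < a)%Z -> root_sum a (a * n) = IZR a * CpowZ (-1) n.
Proof.
intros Ha; unfold root_sum.
rewrite sum_n_ext_C with (v := fun _ => CpowZ (-1) n).
- rewrite sum_n_const_C; f_equal.
  replace (S (Z.to_nat a - 1)) with (Z.to_nat a) by lia.
  now rewrite INR_IZR_INZ, Z2Nat.id by lia.
- intros j _.
  replace ((2 * Z.of_nat j + 1) * (a * n))%Z
    with (a * (2 * (Z.of_nat j * n) + n))%Z by ring.
  rewrite CpowZ_omega_mult, CpowZ_m1_add, CpowZ_m1_even by lia; ring.
Qed.

(** A geometric sum with ratio [omega^(2k) <> 1]; its numerator contains
    [1 - omega^(2ak) = 1 - (-1)^(2k) = 0]. *)
Lemma root_sum_not_multiple (a k : Z) :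
  (0 < a)%Z -> ~ (a | k)%Z -> root_sum a k = 0.
Proof.
intros Ha Hk.
assert (Hz : 1 - CpowZ (omega a) (2 * k) <> 0).
{ intros E; apply Hk, CpowZ_omega_eq_1; [lia|].
  replace (CpowZ (omega a) (2 * k)) with (1 - (1 - CpowZ (omega a) (2 * k))) by ring.
  rewrite E; ring. }
assert (T : forall J, (1 - CpowZ (omega a) (2 * k)) *
    sum_n (fun j => CpowZ (omega a) ((2 * Z.of_nat j + 1) * k)) J =
    CpowZ (omega a) k * (1 - CpowZ (omega a) (2 * Z.of_nat (S J) * k))).
{ induction J as [|J IH].
  - rewrite sum_O.
    replace ((2 * Z.of_nat 0 + 1) * k)%Z with k by lia.
    replace (2 * Z.of_nat 1 * k)%Z with (2 * k)%Z by lia; cring.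
  - rewrite sum_n_S, Cmult_plus_distr_l, IH.
    replace ((2 * Z.of_nat (S J) + 1) * k)%Z with (2 * Z.of_nat (S J) * k + k)%Z by ring.
    replace (2 * Z.of_nat (S (S J)) * k)%Z with (2 * Z.of_nat (S J) * k + 2 * k)%Z by lia.
    unfold omega; rewrite !CpowZ_Cexp_add; cring. }
specialize (T (Z.to_nat a - 1)%nat); fold (root_sum a k) in T.
replace (2 * Z.of_nat (S (Z.to_nat a - 1)) * k)%Z with (a * (2 * k))%Z in T
  by (replace (Z.of_nat (S (Z.to_nat a - 1))) with a by lia; ring).
rewrite CpowZ_omega_mult, CpowZ_m1_even in T by lia.
replace (root_sum a k) with
  (/ (1 - CpowZ (omega a) (2 * k)) * ((1 - CpowZ (omega a) (2 * k)) * root_sum a k))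
  by (field; auto).
rewrite T; ring.
Qed.

Lemma Cmod_root_sum_le (a k : Z) : (0 < a)%Z -> (Cmod (root_sum a k) <= IZR a)%R.
Proof.
intros Ha; unfold root_sum.
eapply Rle_trans; [apply Cmod_sum_n_le with (v := fun _ => 1%R)|].
- intros j _; rewrite Cmod_CpowZ_omega by lia; lra.
- rewrite sum_n_const, Rmult_1_r.
  replace (S (Z.to_nat a - 1)) with (Z.to_nat a) by lia.
  rewrite INR_IZR_INZ, Z2Nat.id by lia; lra.
Qed.

(** * Geometric bounds and the Lambert series *)

Lemma pow_le_antitone (r : R) (m n : nat) :
  (0 <= r <= 1)%R -> (m <= n)%nat -> (r ^ n <= r ^ m)%R.
Proof.
intros Hr Hmn; replace n with (m + (n - m))%nat by lia.
rewrite pow_add; rewrite <- (Rmult_1_r (r ^ m)) at 2.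
apply Rmult_le_compat_l; [apply pow_le; lra|].
rewrite <- (pow1 (n - m)); apply pow_incr; lra.
Qed.

Lemma one_minus_pow_neq_0 (q : C) (n : nat) :
  (Cmod q < 1)%R -> (0 < n)%nat -> (1 - Cmod q <= Cmod (1 - q ^ n))%R.
Proof.
intros Hq Hn.
assert (H := Cmod_ge_minus 1 (- q ^ n)); rewrite Cmod_opp, Cmod_pow, Cmod_1 in H.
assert (P := pow_le_antitone (Cmod q) 1 n ltac:(split; [apply Cmod_ge_0|lra]) Hn).
rewrite pow_1 in P; unfold Cminus; lra.
Qed.

Lemma Cmod_lambert_coef_le (q : C) (k : nat) :
  (Cmod q < 1)%R -> (Cmod (lambert_coef q (S k)) <= Cmod q ^ k / (1 - Cmod q))%R.
Proof.
intros Hq; unfold lambert_coef.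
assert (P := Cmod_ge_0 q).
assert (D := one_minus_pow_neq_0 q (2 * S k) Hq ltac:(lia)).
assert (D0 : 1 - q ^ (2 * S k) <> 0) by (apply Cmod_gt_0; lra).
assert (I : (1 <= INR (S k))%R) by (rewrite S_INR; assert (Q := pos_INR k); lra).
rewrite Cmod_div, Cmod_mult, Cmod_pow, Cmod_R, Rabs_pos_eq
  by (lra || apply Cmult_neq_0; auto using INR_S_neq_0).
unfold Rdiv; apply Rmult_le_compat.
- now apply pow_le.
- left; apply Rinv_0_lt_compat; nra.
- apply pow_le_antitone; [lra|lia].
- apply Rinv_le_contravar; nra.
Qed.

Lemma ex_series_lambert (q : C) (V : nat -> C) (B : R) :
  (Cmod q < 1)%R -> (forall k, (Cmod (V k) <= B)%R) ->
  exists s : C, is_series (fun k => V k * lambert_coef q (S k)) s.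
Proof.
intros Hq HV; apply ex_series_C.
apply ex_series_Cmod_le with (fun k => B / (1 - Cmod q) * Cmod q ^ k)%R.
- intros k; rewrite Cmod_mult.
  apply Rle_trans with (B * (Cmod q ^ k / (1 - Cmod q)))%R; [|right; unfold Rdiv; ring].
  apply Rmult_le_compat; auto using Cmod_ge_0, Cmod_lambert_coef_le.
- apply (ex_series_scal (V := R_NormedModule)), ex_series_geom.
  rewrite Rabs_pos_eq; auto using Cmod_ge_0.
Qed.

Lemma sum_n_odd_pow (q : C) (r M : nat) :
  1 - q ^ (2 * r) <> 0 ->
  sum_n (fun m => (q ^ (2 * m + 1)) ^ r) M =
  q ^ r * (1 - (q ^ (2 * r)) ^ S M) / (1 - q ^ (2 * r)).
Proof.
intros H; induction M as [|M IH].
- rewrite sum_O; replace (2 * 0 + 1)%nat with 1%nat by lia.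
  rewrite !Cpow_1_r; cfield; auto.
- rewrite sum_n_S, IH, (Cpow_S _ (S M)).
  replace ((q ^ (2 * S M + 1)) ^ r) with (q ^ r * (q ^ (2 * r)) ^ S M).
  + generalize ((q ^ (2 * r)) ^ S M); intros y; cfield; auto.
  + rewrite <- !Cpow_mult_r, <- Cpow_add_r; f_equal; lia.
Qed.

(** Partial sums over [m] are summed in closed form under the sum over [k], which
    leaves a remainder [O(|q|^M)]; no double series is needed. *)
Lemma is_series_lambert (q : C) (V T : nat -> C) (B : R) (s : C) :
  (Cmod q < 1)%R -> (forall k, (Cmod (V k) <= B)%R) ->
  (forall m, is_series (fun k => V k * ((q ^ (2 * m + 1)) ^ S k / INR (S k))) (- T m)) ->
  is_series (fun k => V k * lambert_coef q (S k)) s ->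
  is_series T (- s).
Proof.
intros Hq HV HT Hs; apply is_series_C_iff.
assert (P := Cmod_ge_0 q).
assert (HB : (0 <= B)%R) by (eapply Rle_trans; [apply Cmod_ge_0|apply (HV O)]).
assert (G := is_series_geom (Cmod q) ltac:(rewrite Rabs_pos_eq; lra)).
apply is_lim_seq_squeeze_0 with
  (fun M => B / (1 - Cmod q) * / (1 - Cmod q) * Cmod q ^ M)%R.
2:{ replace (Finite 0) with (Rbar_mult (B / (1 - Cmod q) * / (1 - Cmod q))%R 0)
      by (simpl; f_equal; ring).
    apply is_lim_seq_scal_l, is_lim_seq_geom; rewrite Rabs_pos_eq; auto. }
intros M; split; [apply Cmod_ge_0|].
assert (H1 := is_series_sum_n _ (fun m => - T m) M (fun m _ => HT m)).
assert (H2 := is_series_plus_C _ _ _ _ H1 (is_series_scal_C (- (1)) _ _ Hs)).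
replace (Cmod (sum_n T M - - s)) with (Cmod (sum_n (fun m => - T m) M + - (1) * s)).
2:{ replace (sum_n (fun m => - T m) M) with (- (1) * sum_n T M).
    - rewrite <- Cmod_opp; f_equal; cring.
    - rewrite <- sum_n_scal_C; apply sum_n_ext_C; intros; ring. }
apply (Cmod_series_le _ (fun k => (B / (1 - Cmod q) * Cmod q ^ M) * Cmod q ^ k)%R _ _) with (2 := H2).
2:{ replace (B / (1 - Cmod q) * / (1 - Cmod q) * Cmod q ^ M)%R
      with ((B / (1 - Cmod q) * Cmod q ^ M) * / (1 - Cmod q))%R by ring.
    apply (is_series_scal (V := R_NormedModule)), G. }
intros k.
assert (D := one_minus_pow_neq_0 q (2 * S k) Hq ltac:(lia)).
assert (D0 : 1 - q ^ (2 * S k) <> 0) by (apply Cmod_gt_0; lra).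
replace (sum_n _ M) with (V k / INR (S k) * sum_n (fun m => (q ^ (2 * m + 1)) ^ S k) M).
2:{ rewrite <- sum_n_scal_C; apply sum_n_ext_C; intros m _; unfold Cdiv; ring. }
rewrite sum_n_odd_pow by auto.
(* Truncating the sum over [m] at [M] changes the coefficient by the factor [1 - q^(2(k+1)(M+1))];
   only the tail is left to bound. *)
match goal with |- (Cmod ?w <= _)%R => replace w
  with (- (V k * lambert_coef q (S k) * (q ^ (2 * S k)) ^ S M)) end.
2:{ unfold lambert_coef; generalize ((q ^ (2 * S k)) ^ S M); intros y.
    field; split; auto using INR_S_neq_0. }
rewrite Cmod_opp, !Cmod_mult, <- Cpow_mult_r, Cmod_pow.
apply Rle_trans with (B * (Cmod q ^ k / (1 - Cmod q)) * Cmod q ^ M)%R;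
  [|right; unfold Rdiv; ring].
apply Rmult_le_compat; auto using Cmod_ge_0, pow_le.
- apply Rmult_le_pos; apply Cmod_ge_0.
- apply Rmult_le_compat; auto using Cmod_ge_0, Cmod_lambert_coef_le.
- apply pow_le_antitone; [lra|nia].
Qed.

(** Exchanging the finite sum over [j] with the power series collects [zeta^(r-b)] and [zeta^(-r-b)]
    at [Q^r], with [zeta = omega^(2j+1)]. *)
Lemma Clog_root_sum (a b : Z) (Q : C) :
  (0 < a)%Z -> (Cmod Q < 1)%R ->
  is_series
    (fun k => (root_sum a (Z.of_nat (S k) - b) + root_sum a (- Z.of_nat (S k) - b)) *
              (Q ^ S k / INR (S k)))
    (- sum_n (fun j => CpowZ (omega a) (- (2 * Z.of_nat j + 1) * b) *
        (Clog (1 - CpowZ (omega a) (2 * Z.of_nat j + 1) * Q) +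
         Clog (1 - CpowZ (omega a) (- 2 * Z.of_nat j - 1) * Q))) (Z.to_nat a - 1)).
Proof.
intros Ha HQ.
assert (L : forall l, is_series (fun k => CpowZ (omega a) (l * Z.of_nat (S k)) * (Q ^ S k / INR (S k)))
  (- Clog (1 - CpowZ (omega a) l * Q))).
{ intros l.
  apply is_series_ext_C with (fun k => (CpowZ (omega a) l * Q) ^ S k / INR (S k)).
  - intros k; rewrite Cpow_mult_l; unfold omega; rewrite CpowZ_Cexp_pow; unfold Cdiv; ring.
  - apply is_series_Clog; rewrite Cmod_mult, Cmod_CpowZ_omega by lia; lra. }
replace (- sum_n _ _) with (sum_n (fun j => CpowZ (omega a) (- (2 * Z.of_nat j + 1) * b) *
        (- Clog (1 - CpowZ (omega a) (2 * Z.of_nat j + 1) * Q) +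
         - Clog (1 - CpowZ (omega a) (- 2 * Z.of_nat j - 1) * Q))) (Z.to_nat a - 1)).
2:{ match goal with |- _ = - ?w => replace (- w) with (- (1) * w) by cring end.
    rewrite <- sum_n_scal_C; apply sum_n_ext_C; intros j _; ring. }
apply is_series_ext_C with (2 := is_series_sum_n _ _ _ (fun j _ =>
  is_series_scal_C (CpowZ (omega a) (- (2 * Z.of_nat j + 1) * b)) _ _
  (is_series_plus_C _ _ _ _ (L (2 * Z.of_nat j + 1)%Z) (L (- 2 * Z.of_nat j - 1)%Z)))).
intros k; unfold root_sum; rewrite <- sum_n_plus_C, Cmult_comm, <- sum_n_scal_C.
apply sum_n_ext_C; intros j _.
replace ((2 * Z.of_nat j + 1) * (Z.of_nat (S k) - b))%Z with
  (- (2 * Z.of_nat j + 1) * b + (2 * Z.of_nat j + 1) * Z.of_nat (S k))%Z by ring.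
replace ((2 * Z.of_nat j + 1) * (- Z.of_nat (S k) - b))%Z with
  (- (2 * Z.of_nat j + 1) * b + (- 2 * Z.of_nat j - 1) * Z.of_nat (S k))%Z by ring.
unfold omega; rewrite !CpowZ_Cexp_add; ring.
Qed.

(** * Sums over the integers *)

Lemma is_series_incr_1_C (u : nat -> C) (l : C) :
  is_series u l -> is_series (fun k => u (S k)) (l - u O).
Proof.
intros H; apply (is_series_incr_1 (V := C_NormedModule)).
match goal with |- is_series _ ?s => replace s with l; auto end.
match goal with |- _ = plus ?p ?q => change (plus p q) with (p + q) end; ring.
Qed.

Lemma is_series_decr_1_C (u : nat -> C) (l : C) :
  is_series (fun k => u (S k)) l -> is_series u (l + u O).
Proof.
intros H; apply (is_series_decr_1 (V := C_NormedModule)).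
match goal with |- is_series _ ?s => replace s with l; auto end.
match goal with |- _ = plus ?p (opp ?q) => change (plus p (opp q)) with (p + - q) end; ring.
Qed.

(** Separate convergence of the two halves makes the sum invariant under shifts: each unit shift
    moves one term across. *)
Definition is_sum_Z (G : Z -> C) (s : C) : Prop :=
  exists s1 s2 : C,
    is_series (fun k : nat => G (Z.of_nat k)) s1 /\
    is_series (fun k : nat => G (- Z.of_nat (S k))%Z) s2 /\
    s = s1 + s2.

Lemma is_sum_Z_ext (G H : Z -> C) (s : C) :
  (forall r, G r = H r) -> is_sum_Z G s -> is_sum_Z H s.
Proof.
intros E (s1 & s2 & H1 & H2 & ->); exists s1, s2; split; [|split; auto];
  [revert H1|revert H2]; apply is_series_ext_C; auto.
Qed.

Lemma is_sum_Z_succ (G : Z -> C) (s : C) :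
  is_sum_Z G s -> is_sum_Z (fun r => G (r + 1)%Z) s.
Proof.
intros (s1 & s2 & H1 & H2 & ->).
exists (s1 - G 0%Z), (s2 + G 0%Z); split; [|split; [|ring]].
- apply is_series_incr_1_C in H1; revert H1; apply is_series_ext_C.
  intros k; f_equal; lia.
- apply (is_series_decr_1_C (fun k => G (- Z.of_nat (S k) + 1)%Z)).
  revert H2; apply is_series_ext_C; intros k; f_equal; lia.
Qed.

Lemma is_sum_Z_pred (G : Z -> C) (s : C) :
  is_sum_Z G s -> is_sum_Z (fun r => G (r - 1)%Z) s.
Proof.
intros (s1 & s2 & H1 & H2 & ->).
exists (s1 + G (-1)%Z), (s2 - G (-1)%Z); split; [|split; [|ring]].
- apply (is_series_decr_1_C (fun k => G (Z.of_nat k - 1)%Z)).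
  revert H1; apply is_series_ext_C; intros k; f_equal; lia.
- apply is_series_incr_1_C in H2; revert H2; apply is_series_ext_C.
  intros k; f_equal; lia.
Qed.

Lemma is_sum_Z_shift (G : Z -> C) (s : C) (b : Z) :
  is_sum_Z G s -> is_sum_Z (fun r => G (r + b)%Z) s.
Proof.
intros H; induction b as [|b IH|b IH] using Z.peano_ind.
- revert H; apply is_sum_Z_ext; intros r; f_equal; lia.
- apply is_sum_Z_succ in IH; revert IH; apply is_sum_Z_ext; intros r; f_equal; lia.
- apply is_sum_Z_pred in IH; revert IH; apply is_sum_Z_ext; intros r; f_equal; lia.
Qed.

(** The terms between multiples of [A] vanish, so the new partial sums are the subsequence of the
    old ones at [A n]. *)
Lemma is_series_sparse (A : nat) (f : nat -> C) (l : C) :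
  (0 < A)%nat ->
  (forall s, ~ Nat.divide A s -> f s = 0) ->
  is_series f l -> is_series (fun k => f (A * k)%nat) l.
Proof.
intros HA Hf Hl.
assert (E : forall n, sum_n (fun k => f (A * k)%nat) n = sum_n f (A * n)).
{ assert (I : forall n i, (i < A)%nat -> sum_n f (A * n + i) = sum_n f (A * n)).
  { intros n; induction i as [|i IH]; intros Hi; [now rewrite Nat.add_0_r|].
    rewrite Nat.add_succ_r, sum_n_S, IH by lia; rewrite Hf.
    - cring.
    - intros [m Hm]; assert (C : (m <= n \/ n + 1 <= m)%nat) by lia; destruct C; nia. }
  induction n as [|n IH].
  - rewrite sum_O, Nat.mul_0_r, sum_O; reflexivity.
  - rewrite sum_n_S, IH; replace (A * S n)%nat with (S (A * n + (A - 1))) by lia.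
    now rewrite sum_n_S, I by lia. }
apply is_series_C_iff; apply is_series_C_iff in Hl.
apply (is_lim_seq_subseq _ _ (fun n => (A * n)%nat)) in Hl.
- revert Hl; apply is_lim_seq_ext; intros n; now rewrite E.
- apply eventually_subseq; intros n; nia.
Qed.

(** For [N = S n] the window is [-n, ..., n]; both one-sided sums count index 0. The degenerate
    window [N = 0] does not affect the limit. *)
Lemma sym_partial_sum (g : Z -> C) (n : nat) :
  sum_n_m (fun k : nat => g (Z.of_nat k - Z.of_nat (S n))%Z) 1 (2 * S n - 1) =
  sum_n (fun k => g (Z.of_nat k)) n + sum_n (fun k => g (- Z.of_nat k)%Z) n - g 0%Z.
Proof.
induction n as [|n IH].
- rewrite !sum_O; replace (2 * 1 - 1)%nat with 1%nat by lia.
  rewrite sum_n_n; simpl; cring.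
- replace (2 * S (S n) - 1)%nat with (S (S (2 * S n - 1))) by lia.
  rewrite sum_Sn_m by lia; rewrite sum_n_Sm by lia; rewrite <- sum_n_m_S.
  rewrite (sum_n_m_ext _ (fun k : nat => g (Z.of_nat k - Z.of_nat (S n))%Z))
    by (intros k; f_equal; lia).
  rewrite IH, !sum_n_S.
  replace (Z.of_nat 1 - Z.of_nat (S (S n)))%Z with (- Z.of_nat (S n))%Z by lia.
  replace (Z.of_nat (S (S (2 * S n - 1))) - Z.of_nat (S (S n)))%Z
    with (Z.of_nat (S n)) by lia.
  repeat match goal with |- context [plus ?p ?q] => change (plus p q) with (Cplus p q) end.
  cring.
Qed.

Lemma is_sym_sum_of_series (g : Z -> C) (s1 s2 : C) :
  is_series (fun k => g (Z.of_nat k)) s1 ->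
  is_series (fun k => g (- Z.of_nat k)%Z) s2 ->
  is_sym_sum_Z g (s1 + s2 - g 0%Z).
Proof.
intros H1 H2; unfold is_sym_sum_Z; apply filterlim_C_iff, is_lim_seq_incr_1.
apply is_series_C_iff in H1; apply is_series_C_iff in H2.
assert (H := is_lim_seq_plus' _ _ _ _ H1 H2); rewrite Rplus_0_r in H.
revert H; apply is_lim_seq_squeeze_0; intros n; split; [apply Cmod_ge_0|].
rewrite sym_partial_sum.
eapply Rle_trans; [|apply Cmod_triangle]; right; f_equal; cring.
Qed.

Lemma is_sym_sum_progression (a b : Z) (G : Z -> C) (s : C) :
  (0 < a)%Z ->
  (forall r, ~ (a | r - b)%Z -> G r = 0) ->
  is_sum_Z G s -> is_sym_sum_Z (fun n => G (a * n + b)%Z) s.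
Proof.
intros Ha HG Hs.
assert (D : forall k, ~ Nat.divide (Z.to_nat a) k -> ~ (a | Z.of_nat k)%Z).
{ intros k Hk [m Hm]; apply Hk; exists (Z.to_nat m); nia. }
destruct (is_sum_Z_shift G s b Hs) as (s1 & s2 & H1 & H2 & ->).
(* The negative half is extended by its index 0 term [G b], which the symmetric sum then subtracts
   once. *)
replace (s1 + s2) with (s1 + (s2 + G b) - G (a * 0 + b)%Z)
  by (rewrite Z.mul_0_r; simpl; ring).
apply (is_sym_sum_of_series (fun n => G (a * n + b)%Z)).
- apply (is_series_sparse (Z.to_nat a)) in H1; [|lia|].
  + revert H1; apply is_series_ext_C; intros k; f_equal; lia.
  + intros k Hk; apply HG; replace (Z.of_nat k + b - b)%Z with (Z.of_nat k) by ring; auto.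
- apply (is_series_decr_1_C (fun k => G (- Z.of_nat k + b)%Z)) in H2.
  apply (is_series_sparse (Z.to_nat a)) in H2; [|lia|].
  + revert H2; apply is_series_ext_C; intros k; f_equal; lia.
  + intros k Hk; apply HG; replace (- Z.of_nat k + b - b)%Z with (- Z.of_nat k)%Z by ring.
    intros HD; apply (D k Hk); now apply Z.divide_opp_r.
Qed.

(** * Existence of the logarithms and the final identity *)

(** Induction on [n] collects the finitely many witnesses into one function without a choice
    axiom. *)
Lemma finite_choice (P : nat -> C -> Prop) (n : nat) :
  (forall j, (j < n)%nat -> exists l, P j l) ->
  exists L : nat -> C, forall j, (j < n)%nat -> P j (L j).
Proof.
induction n as [|n IH]; intros H.
- exists (fun _ => 0); lia.
- destruct IH as [L HL]; [auto|].
  destruct (H n) as [l Hl]; [auto|].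
  exists (fun j => if Nat.eq_dec j n then l else L j).
  intros j Hj; destruct (Nat.eq_dec j n) as [->|E]; auto.
  apply HL; lia.
Qed.

(** [|Clog (1 - w)| <= 2 |w| / (1 - |w|)] with [|w| = |q|^(2m+1)] gives a geometric majorant; 4
    counts both logarithms. *)
Lemma is_log_prod2_exists (q u v : C) :
  (Cmod q < 1)%R -> Cmod u = 1%R -> Cmod v = 1%R ->
  exists l, is_log_prod2 (fun m => 1 - u * q ^ (2 * m + 1)) (fun m => 1 - v * q ^ (2 * m + 1)) l.
Proof.
intros Hq Hu Hv; apply ex_series_C.
assert (P := Cmod_ge_0 q).
apply ex_series_Cmod_le with (fun m => 4 / (1 - Cmod q) * Cmod q ^ m)%R.
2:{ apply (ex_series_scal (V := R_NormedModule)), ex_series_geom.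
    rewrite Rabs_pos_eq; auto. }
intros m.
assert (B : forall w, Cmod w = 1%R ->
  (Cmod (Clog (1 - w * q ^ (2 * m + 1))) <= 2 / (1 - Cmod q) * Cmod q ^ m)%R).
{ intros w Hw.
  assert (E : Cmod (w * q ^ (2 * m + 1)) = (Cmod q ^ (2 * m + 1))%R)
    by (rewrite Cmod_mult, Hw, Cmod_pow; ring).
  assert (B1 := pow_le_antitone (Cmod q) 1 (2 * m + 1) ltac:(lra) ltac:(lia)).
  assert (B2 := pow_le_antitone (Cmod q) m (2 * m + 1) ltac:(lra) ltac:(lia)).
  assert (B3 := pow_le (Cmod q) (2 * m + 1) P).
  rewrite pow_1 in B1.
  eapply Rle_trans; [apply Cmod_Clog_le; rewrite E; lra|].
  rewrite E; unfold Rdiv; rewrite Rmult_assoc, (Rmult_comm (/ _) (_ ^ m)).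
  apply Rmult_le_compat_l; [lra|]; apply Rmult_le_compat; auto.
  - left; apply Rinv_0_lt_compat; lra.
  - apply Rinv_le_contravar; lra. }
eapply Rle_trans; [apply Cmod_triangle|].
assert (B1 := B u Hu); assert (B2 := B v Hv); lra.
Qed.

Theorem theorem2p1 (a b : Z) (x : C)
  (ha : (2 <= a)%Z) (hab : Z.gcd a b = 1%Z) (hx : (0 < Re x)%R) :
  exists L : nat -> C,
    (forall j : nat, (j < Z.to_nat a)%nat ->
       is_log_prod2
         (fun m : nat => 1 - CpowZ (omega a) (2 * Z.of_nat j + 1) * nome x ^ (2 * m + 1))
         (fun m : nat => 1 - CpowZ (omega a) (- 2 * Z.of_nat j - 1) * nome x ^ (2 * m + 1))
         (L j)) /\
    is_F a b x
      (- (2 * PI / (IZR a * x)) *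
       sum_n_m (fun j : nat => CpowZ (omega a) (- (2 * Z.of_nat j + 1) * b) * L j)
         0 (Z.to_nat a - 1)).
Proof.
assert (Hq := Cmod_nome_lt_1 x hx).
assert (Hx0 := Re_pos_neq_0 x hx).
assert (Ha0 := RtoC_IZR_neq_0 a ltac:(lia)).
(* This keeps [a n + b] away from 0 and makes the weight of [r = 0] vanish. *)
assert (Hb : ~ (a | b)%Z).
{ intros HD; assert (H := Z.gcd_greatest a b a (Z.divide_refl a) HD).
  rewrite hab in H; apply Z.divide_1_r_nonneg in H; lia. }
assert (Ha : (a <> 0)%Z) by lia.
destruct (finite_choice _ (Z.to_nat a) (fun j _ => is_log_prod2_exists (nome x)
  (CpowZ (omega a) (2 * Z.of_nat j + 1)) (CpowZ (omega a) (- 2 * Z.of_nat j - 1)) Hq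
  (Cmod_CpowZ_omega _ _ Ha) (Cmod_CpowZ_omega _ _ Ha))) as [L HL].
exists L; split; [exact HL|].
(* The weight vanishes off the progression [r = a n + b], so summing [G] over all integers amounts
   to summing over [n]. *)
set (G := fun r => root_sum a (r - b) * lambert_coef (nome x) (Z.abs_nat r)).
destruct (ex_series_lambert (nome x) (fun k => root_sum a (Z.of_nat (S k) - b)) (IZR a) Hq)
  as [s1 H1]; [intros; apply Cmod_root_sum_le; lia|].
destruct (ex_series_lambert (nome x) (fun k => root_sum a (- Z.of_nat (S k) - b)) (IZR a) Hq)
  as [s2 H2]; [intros; apply Cmod_root_sum_le; lia|].
assert (G0 : G 0%Z = 0).
{ unfold G; rewrite root_sum_not_multiple; [ring|lia|].
  intros HD; apply Hb; apply Z.divide_opp_r; now replace (- b)%Z with (0 - b)%Z by ring. }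
assert (HG : is_sum_Z G (s1 + s2)).
{ exists s1, s2; split; [|split; auto].
  - replace s1 with (s1 + G (Z.of_nat 0)) by (simpl; rewrite G0; ring).
    apply (is_series_decr_1_C (fun k => G (Z.of_nat k))).
    revert H1; apply is_series_ext_C; intros k; unfold G; do 2 f_equal; lia.
  - revert H2; apply is_series_ext_C; intros k; unfold G; do 2 f_equal; lia. }
assert (HS : sum_n_m (fun j : nat => CpowZ (omega a) (- (2 * Z.of_nat j + 1) * b) * L j)
         0 (Z.to_nat a - 1) = - (s1 + s2)).
(* The same partial sums over [m] have two limits: one by the definition of [L], the other by the
   Lambert series. *)
{ apply (filterlim_C_unique (sum_n (fun m => sum_n (fun j =>
    CpowZ (omega a) (- (2 * Z.of_nat j + 1) * b) *
        (Clog (1 - CpowZ (omega a) (2 * Z.of_nat j + 1) * nome x ^ (2 * m + 1)) +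
         Clog (1 - CpowZ (omega a) (- 2 * Z.of_nat j - 1) * nome x ^ (2 * m + 1))))
    (Z.to_nat a - 1)))).
  - apply (is_series_sum_n (fun j m => CpowZ (omega a) (- (2 * Z.of_nat j + 1) * b) *
        (Clog (1 - CpowZ (omega a) (2 * Z.of_nat j + 1) * nome x ^ (2 * m + 1)) +
         Clog (1 - CpowZ (omega a) (- 2 * Z.of_nat j - 1) * nome x ^ (2 * m + 1))))
      (fun j => CpowZ (omega a) (- (2 * Z.of_nat j + 1) * b) * L j)).
    intros j Hj; apply is_series_scal_C, HL; lia.
  - apply (is_series_lambert (nome x) (fun k =>
      root_sum a (Z.of_nat (S k) - b) + root_sum a (- Z.of_nat (S k) - b)) _ (IZR a + IZR a)); auto.
    + intros k; eapply Rle_trans; [apply Cmod_triangle|].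
      apply Rplus_le_compat; apply Cmod_root_sum_le; lia.
    + intros m; apply Clog_root_sum; [lia|].
      rewrite Cmod_pow; assert (P := Cmod_ge_0 (nome x)).
      assert (B := pow_le_antitone (Cmod (nome x)) 1 (2 * m + 1) ltac:(lra) ltac:(lia)).
      rewrite pow_1 in B; lra.
    + apply is_series_ext_C with (2 := is_series_plus_C _ _ _ _ H1 H2).
      intros k; ring. }
rewrite HS.
replace (- (2 * PI / (IZR a * x)) * - (s1 + s2)) with (2 * PI / (IZR a * x) * (s1 + s2)) by ring.
exists (fun n => 2 * PI / (IZR a * x) * G (a * n + b)%Z); split.
- intros n.
  replace (2 * PI / (IZR a * x) * G (a * n + b)%Z) with
    (2 * PI / x * (CpowZ (-1) n * lambert_coef (nome x) (Z.abs_nat (a * n + b)))).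
  + apply F_term_inner_sum; auto.
    intros E; apply Hb; exists (- n)%Z; lia.
  (* On the progression the weight is [a (-1)^n], and the factor [a] cancels the one in the
     prefactor. *)
  + unfold G; replace (a * n + b - b)%Z with (a * n)%Z by ring.
    rewrite root_sum_multiple by lia; field; auto.
- apply (is_sym_sum_progression a b (fun r => 2 * PI / (IZR a * x) * G r)).
  + lia.
  + intros r Hr; unfold G; rewrite root_sum_not_multiple by (lia || auto); ring.
  + destruct HG as (t1 & t2 & T1 & T2 & ->).
    exists (2 * PI / (IZR a * x) * t1), (2 * PI / (IZR a * x) * t2).
    split; [|split; [|ring]]; now apply is_series_scal_C.
Qed.
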